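(* Let $0<\sigma<1$ and let $c<\frac{\sigma(1-\sigma)}{4(7+3\sigma)}$. There exist an absolute constant $M\ge 0$ and a constant $\kappa>0$ depending only on $\sigma$ and $c$ such that the following holds. Let $\delta>0$, $C>0$, and let $A\subset[1,2]$ be a $\delta$-discretized set of Lebesgue measure $|A|=\delta^{1-\sigma}$. Suppose that for all intervals $I\subset\mathbb{R}$ we have $$|A\cap I|\leq C|I|^{\sigma}|A|.$$ Then $$|A+A|+|A.A|\ \geq\ \kappa\, C^{-M}\,\delta^{-c}\,|A|.$$
   Context: For a measurable set $X\subset\mathbb{R}$, $|X|$ denotes Lebesgue measure. For $\delta>0$, a set $A\subset\mathbb{R}$ is called $\delta$-discretized if it is a union of closed intervals of length $\delta$. $A+A=\{a+a':a,a'\in A\}$ and $A.A=\{aa':a,a'\in A\}$. *)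

(* Defs.v *)
From HB Require Import structures.
From mathcomp Require Import all_boot all_order all_algebra.
From mathcomp Require Import all_classical all_reals all_analysis.

Set Implicit Arguments.
Unset Strict Implicit.
Unset Printing Implicit Defensive.

Import Order.TTheory GRing.Theory Num.Theory.
Import numFieldNormedType.Exports.

Local Open Scope classical_set_scope.
Local Open Scope ring_scope.

(* The union ranges over an arbitrary set X of left endpoints, possibly
   infinite, and the intervals may overlap. *)
Definition delta_discretized (R : realType) (delta : R) (A : set R) : Prop :=
  exists X : set R, A = \bigcup_(x in X) `[x, x + delta]%classic.

Definition sumset (R : realType) (A B : set R) : set R :=
  [set a + b | a in A & b in B].

Definition prodset (R : realType) (A B : set R) : set R :=
  [set a * b | a in A & b in B].

(* Main.v *)
Require Import Defs.
From HB Require Import structures.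
From mathcomp Require Import all_boot all_order all_algebra.
From mathcomp Require Import finmap.
From mathcomp Require Import all_classical all_reals all_analysis.
From mathcomp Require Import zify ring lra.

Set Implicit Arguments.
Unset Strict Implicit.
Unset Printing Implicit Defensive.

Import Order.TTheory GRing.Theory Num.Theory.
Import numFieldNormedType.Exports.

Local Open Scope classical_set_scope.
Local Open Scope ring_scope.

(** Put [n = 1 / delta] and replace [A] by the set of the integers [k] with [k / n] in
    [A].  It has about [n `^ sigma] elements, an interval of length [l] contains at
    most a constant times [C * l `^ sigma] of them, and if the conclusion fails then
    its sumset and its (rounded) product set have at most [K] times as many elements,
    with [K] about [n `^ c].  The theorem follows from an inequality between these
    parameters, [discrete_sum_product]: [n `^ (sigma * (1 - sigma))] is at most
    [K `^ (26 + 12 * sigma)] up to a constant, a power of [C] and a power of a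
    logarithm.  As [26 + 12 * sigma] is less than [4 * (7 + 3 * sigma)], this
    contradicts the bound on [c].

    The argument follows the sum-product theorem over prime fields.  A small product
    set gives a point [b] and a set [B] of points [a] for which [a A] and [b A] share
    many elements ([popular_dilates]).  By the triangle inequalities of Ruzsa and
    Petridis every set [b1 A - b2 A + b3 A - b4 A] with all [bi] in [B] is then only a
    power of [K] larger than [A]; moreover the part of it in an interval of length [F]
    is smaller still, by the factor [(F / n) `^ sigma] ([card_linear_form]).  So the
    values of the forms [e x + f y], where [e] and [f] are differences of elements of
    [B], are few.  Two opposite situations are compared with this bound.

    Let [Q] be the set of the quotients [e / f] with [f] at least a threshold [T], and
    let [e / f] be in [Q] and in the unit interval.  If [f / (e + f)] or [e / (e + f)]
    is far from [Q], then a form attached to that point is nearly injective on the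
    pairs for which [x - y] stays in a translate of [B], and its image is too large as
    long as [T] is small ([quotient_near]).  Using the shift by [1] instead of a
    halving keeps the cost low, since a small sumset directly provides many pairs with
    [x - y] in a translate of [B] ([many_sums]).

    So for [T] up to a suitable size [Q] is closed, up to an error [s], under
    [x / (1 + x)] and [1 / (1 + x)], the inverse branches of the Farey map.  These maps
    generate all continued fractions, but the first has a neutral fixed point at [0],
    and [Q] need not be dense at the scale [s].  What remains true is that words with
    few digits of moderate size have cylinders that fill half of the unit interval, and
    along such words the errors add up to [s] times the square of a logarithm
    ([farey_measure]).  Hence [Q] carries a measure of mass at least [1 / 2] almost
    dominated by Lebesgue measure.

    Averaging over this measure the number of collisions of [e x + f y] on [A * A]
    shows that for some [e / f] in [Q] the form takes many values ([energy_upper]),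
    against the bound above ([dense_bound]).  Choosing [T] as large as the first
    situation allows gives the inequality. *)

(** * Counting in finite sets *)

Section Counting.
Local Open Scope fset_scope.
Local Open Scope ring_scope.

Lemma leq_card_inj (T T' : choiceType) (f : T -> T') (A : {fset T}) (B : {fset T'}) :
  {in A &, injective f} -> (forall x, x \in A -> f x \in B) ->
  (#|` A| <= #|` B|)%N.
Proof.
move=> injf sub; rewrite -(card_in_imfset imfset_key injf).
by apply: fsubset_leq_card; apply/fsubsetP => _ /imfsetP[x /= xA ->]; exact: sub.
Qed.

Lemma leq_b1_imp (b c : bool) : (b -> c) -> (b <= c)%N.
Proof. by case: b => // ->. Qed.

Lemma card_fsetM (T T' : choiceType) (A : {fset T}) (B : {fset T'}) :
  #|` A `*` B| = (#|` A| * #|` B|)%N.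
Proof.
rewrite card_fset_sum1 big_imfset2 /=; last by move=> [a b] [c d] _ _ /= [-> ->].
under eq_bigr do rewrite -card_fset_sum1.
by rewrite big_const_seq count_predT iter_addn_0 mulnC.
Qed.

Lemma card_fset_sumb (T : choiceType) (A : {fset T}) (P : pred T) :
  #|` [fset x in A | P x]| = (\sum_(x <- A) P x)%N.
Proof.
by rewrite card_fset_sum1 big_fset big_mkcond; apply: eq_bigr => x _; case: (P x).
Qed.

Lemma ler_card_fibres (R : numDomainType) (T T' : choiceType) (f : T -> T')
    (A : {fset T}) (r : R) :
  (forall x, x \in A -> #|` [fset y in A | f y == f x]|%:R <= r) ->
  #|` A|%:R <= #|` [fset f x | x in A]|%:R * r.
Proof.
move=> fib; rewrite card_fset_sum1 (partition_big_imfset _ f) /=.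
rewrite card_fset_sum1 !natr_sum big_distrl /= big_seq [leRHS]big_seq.
apply: ler_sum => z /imfsetP[x /= xA ->]; rewrite mul1r.
apply: le_trans (fib x xA); rewrite ler_nat.
by rewrite card_fset_sumb big_mkcond /=; apply: leq_sum => i _; case: eqP.
Qed.

Lemma big_fsetM (M : nmodType) (T T' : choiceType) (A : {fset T}) (B : {fset T'})
    (F : T * T' -> M) :
  \sum_(p <- A `*` B) F p = \sum_(a <- A) \sum_(b <- B) F (a, b).
Proof. by rewrite big_imfset2 //= => -[a b] [c d] _ _ /= [-> ->]. Qed.

Lemma exists_ge_average (T : eqType) (s : seq T) (F : T -> nat) : s != [::] ->
  exists2 x, x \in s & (\sum_(y <- s) F y <= size s * F x)%N.
Proof.
elim: s => // a [_ _|b s IH _].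
  by exists a; rewrite ?inE // big_seq1 mul1n.
have [x xs h] := IH isT; rewrite big_cons.
have [le|lt] := leqP (F a) (F x).
  exists x; first by rewrite inE xs orbT.
  by rewrite [size _]/= mulSn leq_add.
exists a; first by rewrite inE eqxx.
rewrite [size _]/= mulSn leq_add2l; apply: leq_trans h _.
by rewrite leq_mul2l ltnW ?orbT.
Qed.

Lemma exists_ge_averager (R : realDomainType) (T : eqType) (s : seq T) (F : T -> R) :
  s != [::] -> exists2 x, x \in s & \sum_(y <- s) F y <= (size s)%:R * F x.
Proof.
elim: s => // a [_ _|b s IH _].
  by exists a; rewrite ?inE // big_seq1 mul1r.
have [x xs h] := IH isT; rewrite big_cons.
have [le|lt] := lerP (F a) (F x).
  exists x; first by rewrite inE xs orbT.
  by rewrite [size _]/= -natr1 mulrDl mul1r addrC lerD.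
exists a; first by rewrite inE eqxx.
rewrite [size _]/= -natr1 mulrDl mul1r addrC lerD2r; apply: le_trans h _.
by rewrite ler_wpM2l // ltW.
Qed.

Lemma dyadic_index (R : realFieldType) (d t : R) L : d <= 2 ^+ L * t ->
  exists k, [/\ (k <= L)%N, d <= 2 ^+ k * t & k = 0%N \/ 2 ^+ k * t < 2 * d].
Proof.
elim: L => [|L IH] h; first by exists 0%N; split => //; left.
have [/IH[k [kL dk hk]]|lt] := lerP d (2 ^+ L * t).
  by exists k; split => //; exact: leqW.
by exists L.+1; split => //; right; rewrite exprS -mulrA ltr_pM2l.
Qed.

(** Replaces a sum of sizes by a sum over dyadic thresholds, to which the pigeonhole
    principle applies. *)
Lemma sum_pow2 L x : (x < 2 ^ L)%N -> (x <= \sum_(i < L) 2 ^ i * (2 ^ i <= x))%N.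
Proof.
elim: L x => [|L IH] x; first by rewrite expn0 ltnS leqn0 => /eqP ->.
rewrite big_ord_recr /= => xL.
have [le|lt] := leqP (2 ^ L) x; last first.
  by apply: leq_trans (IH _ lt) _; exact: leq_addr.
have -> : (\sum_(i < L) 2 ^ i * (2 ^ i <= x) = \sum_(i < L) 2 ^ i)%N.
  apply: eq_bigr => i _; rewrite (leq_trans _ le) ?muln1 //.
  by rewrite leq_exp2l // ltnW.
have e : (\sum_(i < L) 2 ^ i = (2 ^ L).-1)%N.
  by rewrite predn_exp mul1n; apply: eq_bigr.
have := expn_gt0 2 L; rewrite e; move: xL; rewrite expnS; lia.
Qed.

(** Cauchy-Schwarz over the fibres of [f]. *)
Lemma card_collisions (T T' : choiceType) (f : T -> T') (A : {fset T}) :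
  (#|` A| ^ 2 <= #|` [fset f x | x in A]| *
     \sum_(x <- A) \sum_(y <- A) (f x == f y))%N.
Proof.
set S := [fset f x | x in A].
pose r z := (\sum_(x <- A | f x == z) 1)%N.
have cA : #|` A| = (\sum_(z <- S) r z)%N.
  by rewrite card_fset_sum1 (partition_big_imfset _ f).
have -> : (\sum_(x <- A) \sum_(y <- A) (f x == f y) = \sum_(z <- S) r z ^ 2)%N.
  rewrite (partition_big_imfset _ f) /=; apply: eq_bigr => z _.
  rewrite expnS expn1 {1}/r big_distrl /=; apply: eq_bigr => x /eqP <-.
  rewrite mul1n /r [RHS]big_mkcond /=; apply: eq_bigr => y _.
  by rewrite eq_sym; case: eqP.
rewrite -(leq_pmul2l (isT : 0 < 2)%N) {}cA.
have -> : (2 * (\sum_(z <- S) r z) ^ 2 =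
           \sum_(z <- S) \sum_(w <- S) 2 * (r z * r w))%N.
  rewrite expnS expn1 big_distrl big_distrr /=; apply: eq_bigr => z _.
  by rewrite !big_distrr.
have -> : (2 * (#|` S| * \sum_(z <- S) r z ^ 2) =
           \sum_(z <- S) \sum_(w <- S) (r z ^ 2 + r w ^ 2))%N.
  under [RHS]eq_bigr do rewrite big_split /=.
  rewrite [RHS]big_split /= [X in (_ + X)%N]exchange_big /= addnn -mul2n; congr (_ * _)%N.
  rewrite big_distrr /=; apply: eq_bigr => z _.
  by rewrite big_const_seq count_predT iter_addn_0 mulnC.
by apply: leq_sum => z _; apply: leq_sum => w _; exact: nat_Cauchy.
Qed.

End Counting.

(** * Sumset inequalities *)

Section SumsetInequalities.
Local Open Scope fset_scope.
Local Open Scope ring_scope.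
Variable V : zmodType.
Implicit Types (X Y Z U W : {fset V}) (z : V).

Definition addfs X Y := [fset x + y | x in X, y in Y].

Lemma addfsP X Y z :
  reflect (exists2 x, x \in X & exists2 y, y \in Y & z = x + y)
          (z \in addfs X Y).
Proof.
apply: (iffP (imfset2P _ _ _ _ _)) => [[x xX [y yY ->]]|[x xX [y yY ->]]].
  by exists x => //; exists y.
by exists x => //; exists y.
Qed.

Lemma mem_addfs X Y x y : x \in X -> y \in Y -> x + y \in addfs X Y.
Proof. by move=> xX yY; apply/addfsP; exists x => //; exists y. Qed.

Lemma addfsC X Y : addfs X Y = addfs Y X.
Proof.
by apply/fsetP => z; apply/addfsP/addfsP => -[x xX [y yY ->]];
  exists y => //; exists x => //; rewrite addrC.
Qed.

Lemma addfsA X Y Z : addfs X (addfs Y Z) = addfs (addfs X Y) Z.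
Proof.
apply/fsetP => z; apply/addfsP/addfsP.
  move=> [x xX [_ /addfsP[y yY [t tZ ->]] ->]].
  by exists (x + y); [exact: mem_addfs | exists t => //; rewrite addrA].
move=> [_ /addfsP[x xX [y yY ->]] [t tZ ->]].
by exists x => //; exists (y + t); [exact: mem_addfs | rewrite addrA].
Qed.

Lemma addfsS X X' Y Y' : X `<=` X' -> Y `<=` Y' -> addfs X Y `<=` addfs X' Y'.
Proof.
move=> /fsubsetP sX /fsubsetP sY; apply/fsubsetP => _ /addfsP[x xX [y yY ->]].
by apply: mem_addfs; [exact: sX | exact: sY].
Qed.

Lemma addfs0 X : addfs X fset0 = fset0.
Proof. by apply/fsetP => z; rewrite in_fset0; apply/addfsP => -[x _ []]. Qed.

Lemma card_shift X z : #|` [fset x + z | x in X]| = #|` X|.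
Proof. by apply: card_imfset => x y /addIr. Qed.

Lemma card_addfsl X Y : Y != fset0 -> (#|` X| <= #|` addfs X Y|)%N.
Proof.
case/fset0Pn => y yY; rewrite -(card_shift X y); apply: fsubset_leq_card.
by apply/fsubsetP => _ /imfsetP[x /= xX ->]; exact: mem_addfs.
Qed.

Lemma card_addfsr X Y : X != fset0 -> (#|` Y| <= #|` addfs X Y|)%N.
Proof. by rewrite addfsC; exact: card_addfsl. Qed.

Lemma exists_min_doubling X Y : X != fset0 ->
  exists X', [/\ X' `<=` X, X' != fset0 &
    forall W, W `<=` X -> (#|` addfs X' Y| * #|` W| <= #|` addfs W Y| * #|` X'|)%N].
Proof.
move=> X0; pose F (W : fpowerset X) : rat :=
  #|` addfs (val W) Y|%:R / #|` val W|%:R.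
have XX : X \in fpowerset X by rewrite fpowersetE.
pose P (W : fpowerset X) := val W != fset0.
have PX : P [` XX] by [].
case: (arg_minP F PX) => -[X' /= sX'] PX' minX'; exists X'; split => //.
  by move: (sX'); rewrite fpowersetE.
move=> W sW; have [->|W0] := eqVneq W fset0; first by rewrite cardfs0 muln0.
have sW' : W \in fpowerset X by rewrite fpowersetE.
have /= := minX' [` sW'] W0; rewrite /F /= -(ler_nat rat) !natrM.
have c0 : forall T : {fset V}, T != fset0 -> 0 < #|` T|%:R :> rat.
  by move=> T T0; rewrite ltr0n cardfs_gt0.
by rewrite ler_pdivlMr ?c0 // mulrAC ler_pdivrMr ?c0.
Qed.

(** Petridis's lemma.  A subset [X'] of least doubling ratio against [Y] keeps
    that ratio after adding any further summand.  Adding the elements of [Z] one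
    at a time, the new part of [X' + Y + Z] misses [X'z + Y + z], where [X'z] is
    the set of [x] with [x + Y + z] already covered; minimality says that this
    loss is at least the ratio times the size of [X'z]. *)
Lemma petridis X Y : X != fset0 ->
  exists X', [/\ X' `<=` X, X' != fset0 &
    forall Z, (#|` addfs X' (addfs Y Z)| * #|` X|
               <= #|` addfs X Y| * #|` addfs X' Z|)%N].
Proof.
move=> X0; have [X' [sX' X'0 minX']] := exists_min_doubling Y X0.
exists X'; split => //.
have ratio : forall Z, (#|` addfs X' (addfs Y Z)| * #|` X'|
               <= #|` addfs X' Y| * #|` addfs X' Z|)%N.
  elim/finSet_rect => Z IH.
  have [->|/fset0Pn [z zZ]] := eqVneq Z fset0; first by rewrite !addfs0 cardfs0.
  set Z' := Z `\ z.
  have ZE : Z = z |` Z' by rewrite fsetD1K.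
  have {}IH := IH Z' (fproperD1 zZ).
  pose Wz := [fset x in X' | [forall y : Y, x + (val y + z) \in addfs X' (addfs Y Z')]].
  have WzP x : x \in Wz -> forall y, y \in Y -> x + (y + z) \in addfs X' (addfs Y Z').
    by rewrite !inE /= => /andP[_ /forallP h] y yY; exact: (h [` yY]).
  pose W := [fset x in X' | x + z \in addfs X' Z'].
  have sWWz : W `<=` Wz.
    apply/fsubsetP => x; rewrite !inE /= => /andP[xX' /addfsP[x' x'X [t tZ e]]].
    rewrite xX' /=; apply/forallP => y.
    rewrite addrCA e addrCA; apply: mem_addfs => //.
    by apply: mem_addfs => //; exact: valP.
  have sWz : Wz `<=` X' by apply/fsubsetP => x; rewrite !inE => /andP[].
  have sW : W `<=` X' by exact: fsubset_trans sWWz sWz.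
  (* What [z] adds to the sumset lies in [X' + Y + z] and avoids [Wz + Y + z]. *)
  have up : (#|` addfs X' (addfs Y Z)| + #|` addfs Wz Y|
             <= #|` addfs X' (addfs Y Z')| + #|` addfs X' Y|)%N.
    pose S := [fset u + z | u in addfs X' Y].
    pose S' := [fset u + z | u in addfs Wz Y].
    have -> : #|` addfs X' Y| = #|` S| by rewrite card_shift.
    have -> : #|` addfs Wz Y| = #|` S'| by rewrite card_shift.
    have sS' : S' `<=` S.
      apply: subset_imfset => u /=; apply/fsubsetP; exact: addfsS.
    have sS'2 : S' `<=` addfs X' (addfs Y Z').
      apply/fsubsetP => _ /imfsetP[_ /= /addfsP[x xW [y yY ->]] ->].
      by rewrite -addrA; exact: WzP.
    have sU : addfs X' (addfs Y Z) `<=` addfs X' (addfs Y Z') `|` (S `\` S').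
      apply/fsubsetP => _ /addfsP[x xX' [_ /addfsP[y yY [t tZ ->]] ->]].
      rewrite in_fsetU in_fsetD.
      have [tz|tz] := eqVneq t z.
        subst t; rewrite addrA.
        have -> : x + y + z \in S.
          by apply/imfsetP; exists (x + y) => //=; exact: mem_addfs.
        rewrite andbT; have [h|_] := boolP (x + y + z \in S'); last exact: orbT.
        by rewrite (fsubsetP sS'2).
      apply/orP; left; apply: mem_addfs => //; apply: mem_addfs => //.
      by rewrite !inE tz.
    apply: leq_trans (_ : #|` addfs X' (addfs Y Z') `|` (S `\` S')| + #|` S'| <= _)%N.
      by rewrite leq_add2r; exact: fsubset_leq_card.
    apply: leq_trans (_ : #|` addfs X' (addfs Y Z')| + #|` S `\` S'| + #|` S'| <= _)%N.
      by rewrite leq_add2r; exact: leq_card_fsetU.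
    by rewrite -addnA leq_add2l cardfsDS // subnK // fsubset_leq_card.
  (* What [z] adds to [X' + Z'] is exactly [X' + z] without [W + z]. *)
  have lo : (#|` addfs X' Z'| + #|` X'| <= #|` addfs X' Z| + #|` W|)%N.
    pose S := [fset u + z | u in X'].
    have -> : #|` X'| = #|` S| by rewrite card_shift.
    have -> : #|` W| = #|` [fset u + z | u in W]| by rewrite card_shift.
    rewrite -cardfsUI leq_add //; apply: fsubset_leq_card.
      rewrite fsubUset; apply/andP; split.
        by apply: addfsS => //; exact: fsubD1set.
      by apply/fsubsetP => _ /imfsetP[x /= xX' ->]; exact: mem_addfs.
    apply/fsubsetP => u; rewrite in_fsetI => /andP[uZ /imfsetP[x /= xX' ue]].
    by apply/imfsetP; exists x => //=; rewrite !inE /= xX' /= -ue.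
  have m := minX' Wz (fsubset_trans sWz sX').
  have wc := fsubset_leq_card sWWz.
  move: up lo m wc IH.
  move: (#|` addfs X' (addfs Y Z)|) (#|` addfs Wz Y|) (#|` addfs X' (addfs Y Z')|)
    (#|` addfs X' Y|) (#|` addfs X' Z'|) (#|` X'|) (#|` addfs X' Z|) (#|` W|) (#|` Wz|).
  move=> a b c d e f g h i; nia.
move=> Z; have := ratio Z; have := minX' X (fsubset_refl X).
have : (0 < #|` X'|)%N by rewrite cardfs_gt0.
move: (#|` addfs X' Y|) (#|` X|) (#|` addfs X Y|) (#|` X'|) => d n e f f0 h1 h2.
rewrite -(leq_pmul2r f0).
move: (#|` addfs X' (addfs Y Z)|) (#|` addfs X' Z|) h2 => a g h2.
nia.
Qed.

(** The part of [X] in Petridis's lemma does not depend on [Z], so the lemma can be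
    iterated with [Z] itself a sum of copies of [Y]. *)
Lemma plunnecke4 X Y : X != fset0 ->
  exists X', [/\ X' `<=` X, X' != fset0 &
    (#|` addfs X' (addfs Y (addfs Y (addfs Y Y)))| * #|` X| ^ 4
       <= #|` addfs X Y| ^ 4 * #|` X'|)%N].
Proof.
move=> X0; have [X' [sX' X'0 pet]] := petridis Y X0.
exists X'; split => //.
have e0 : addfs Y [fset 0] = Y.
  apply/fsetP => y; apply/addfsP/idP => [[x xY [z]]|yY].
    by rewrite in_fset1 => /eqP -> ->; rewrite addr0.
  by exists y => //; exists 0; rewrite ?in_fset1 ?addr0.
have e0' : addfs X' [fset 0] = X'.
  apply/fsetP => y; apply/addfsP/idP => [[x xY [z]]|yY].
    by rewrite in_fset1 => /eqP -> ->; rewrite addr0.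
  by exists y => //; exists 0; rewrite ?in_fset1 ?addr0.
have h1 := pet [fset 0]; rewrite e0 e0' in h1.
have h2 := pet Y.
have h3 := pet (addfs Y Y).
have h4 := pet (addfs Y (addfs Y Y)).
have X0' : (0 < #|` X|)%N by rewrite cardfs_gt0.
move: h1 h2 h3 h4 X0'; move: (#|` X|) (#|` addfs X Y|) => n d.
set a1 := #|` addfs X' Y|; set a2 := #|` addfs X' (addfs Y Y)|.
set a3 := #|` addfs X' (addfs Y (addfs Y Y))|.
set a4 := #|` addfs _ _|; move: a1 a2 a3 a4 (#|` X'|) => a1 a2 a3 a4 x.
move=> h1 h2 h3 h4 n0.
have k2 : (a2 * n ^ 2 <= d ^ 2 * x)%N.
  rewrite (leq_trans (_ : _ <= d * (a1 * n))%N) //.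
    by rewrite expnS expn1 mulnA mulnA leq_mul2r h2 orbT.
  by rewrite expnS expn1 -mulnA leq_mul2l h1 orbT.
have k3 : (a3 * n ^ 3 <= d ^ 3 * x)%N.
  rewrite (leq_trans (_ : _ <= d * (a2 * n ^ 2))%N) //.
    by rewrite expnS mulnA mulnA leq_mul2r h3 orbT.
  by rewrite (expnS d) -mulnA leq_mul2l k2 orbT.
rewrite (leq_trans (_ : _ <= d * (a3 * n ^ 3))%N) //.
  by rewrite expnS mulnA mulnA leq_mul2r h4 orbT.
by rewrite (expnS d) -mulnA leq_mul2l k3 orbT.
Qed.

(** The triangle inequality for sums: add to [U + V] the part of [W] with the
    least doubling against [U]. *)
Lemma sum_triangle U V' W :
  (#|` addfs U V'| * #|` W| <= #|` addfs U W| * #|` addfs V' W|)%N.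
Proof.
have [->|W0] := eqVneq W fset0; first by rewrite cardfs0 muln0.
have [W' [sW' W'0 pet]] := petridis U W0.
have h := pet V'.
apply: leq_trans (_ : #|` addfs W' (addfs U V')| * #|` W| <= _)%N.
  by rewrite leq_mul2r card_addfsr ?orbT.
apply: leq_trans h _; rewrite (addfsC W) leq_mul2l; apply/orP; right.
rewrite addfsC; apply: fsubset_leq_card; exact: addfsS.
Qed.

Definition subfs X Y := [fset x - y | x in X, y in Y].

Lemma subfsP X Y z :
  reflect (exists2 x, x \in X & exists2 y, y \in Y & z = x - y)
          (z \in subfs X Y).
Proof.
apply: (iffP (imfset2P _ _ _ _ _)) => [[x xX [y yY ->]]|[x xX [y yY ->]]].
  by exists x => //; exists y.
by exists x => //; exists y.
Qed.

(** Ruzsa's triangle inequality: after fixing a representation [u - v] of each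
    difference, [(u - v, w)] is recovered from [u + w] and [v + w]. *)
Lemma ruzsa_triangle U V' W :
  (#|` subfs U V'| * #|` W| <= #|` addfs U W| * #|` addfs V' W|)%N.
Proof.
rewrite -!card_fsetM.
have cancel (a b c : V) : (a + c) - (b + c) = a - b.
  by rewrite opprD addrACA subrr addr0.
have rep z : exists p : V * V, z \in subfs U V' ->
    [/\ p.1 \in U, p.2 \in V' & z = p.1 - p.2].
  have [/subfsP[u uU [v vV ->]]|_] := boolP (z \in subfs U V'); last by exists (0, 0).
  by exists (u, v).
have /choice[r rP] := rep.
pose g (p : V * V) := ((r p.1).1 + p.2, (r p.1).2 + p.2).
apply: (@leq_card_inj _ _ g).
  move=> [d w] [d' w']; rewrite !in_fsetM /= => /andP[dU wW] /andP[d'U w'W] [e1 e2].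
  have [_ _ ed] := rP _ dU; have [_ _ ed'] := rP _ d'U.
  have dd : d = d'.
    have := congr2 (fun a b => a - b) e1 e2.
    by rewrite !cancel -ed -ed'.
  by subst d'; move/addrI: e1 => ->.
move=> [d w]; rewrite in_fsetM /= => /andP[dU wW]; have [uU vV _] := rP _ dU.
by rewrite /g in_fsetM /=; apply/andP; split; exact: mem_addfs.
Qed.

End SumsetInequalities.

(** * Approximate invariance under the Farey map *)

Section ContinuedFractions.
Variable R : realType.
Implicit Types (x y z p q s : R) (w : seq nat).

Fixpoint cfrac w z : R := if w is a :: w' then (a%:R + cfrac w' z)^-1 else z.

Fixpoint words (m j : nat) : seq (seq nat) :=
  if j is j'.+1 then [seq a :: w | a <- iota 1 m, w <- words m j'] else [:: [::]].

Definition digits (w : seq nat) := all (fun a => 0 < a)%N w.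

Lemma wordsP m j w : w \in words m j ->
  [/\ size w = j, digits w & (sumn w <= j * m)%N].
Proof.
elim: j w => [|j IH] w /=; first by rewrite inE => /eqP ->.
case/allpairsP => -[a v] /= [+ /IH[sv dv nv] ->] /=.
by rewrite mem_iota sv dv => ?; split; lia.
Qed.

Lemma uniq_words m j : uniq (words m j).
Proof.
elim: j => //= j IH; apply: allpairs_uniq => //; first exact: iota_uniq.
by move=> [a v] [b u] _ _ /= [-> ->].
Qed.

Lemma cfrac_ge0 w z : 0 <= z -> 0 <= cfrac w z.
Proof.
by move=> z0; elim: w => //= a w IH; rewrite invr_ge0 addr_ge0.
Qed.

Lemma cfrac_oo w z : digits w -> 0 < z < 1 -> 0 < cfrac w z < 1.
Proof.
move=> dw z01; elim: w dw => //= a w IH /andP[a0 dw].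
have /andP[c0 c1] := IH dw; have a1 : 1 <= a%:R :> R by rewrite ler1n.
by rewrite invr_gt0 invf_lt1; [apply/andP; split; lra | lra].
Qed.

(** The weight of a word, seen through a Moebius map of determinant [1] or [-1]
    and denominator [q + q' * t]: the length of the image of the cylinder of the
    word under that map.  For [q = 1] and [q' = 0] it is the length of the cylinder;
    prefixing a digit to the word amounts to replacing [(q, q')]. *)
Definition cweight q q' w : R :=
  `|cfrac w 1 - cfrac w 0| / ((q + q' * cfrac w 0) * (q + q' * cfrac w 1)).

Lemma cweight_nil q q' : cweight q q' [::] = (q * (q + q'))^-1.
Proof. by rewrite /cweight /= mulr0 addr0 mulr1 subr0 normr1 mul1r. Qed.

Lemma cweight_cons q q' a w : 0 < q -> 0 <= q' -> (0 < a)%N ->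
  cweight q q' (a :: w) = cweight (q * a%:R + q') q w.
Proof.
move=> q0 q'0 a0; rewrite /cweight /=.
have x0 := cfrac_ge0 w (lexx 0); have y0 := cfrac_ge0 w ler01.
move: (cfrac w 0) (cfrac w 1) x0 y0 => x y x0 y0.
have a1 : 1 <= a%:R :> R by rewrite ler1n.
have -> : (a%:R + y)^-1 - (a%:R + x)^-1 = (x - y) / ((a%:R + y) * (a%:R + x)).
  by field; rewrite !lt0r_neq0 //; lra.
have -> : `|(x - y) / ((a%:R + y) * (a%:R + x))| =
          `|y - x| / ((a%:R + y) * (a%:R + x)).
  rewrite normrM normfV distrC [X in _ / X]ger0_norm //.
  by apply: mulr_ge0; lra.
have qa := mulr_gt0 q0 (lt_le_trans ltr01 a1).
have qx := mulr_ge0 (ltW q0) x0; have qy := mulr_ge0 (ltW q0) y0.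
field; do ?[apply/andP; split]; apply/lt0r_neq0; nra.
Qed.

(** Each digit contributes a factor [1 / 2] because
    [(q a + q') (q a + q' + q)] is at least [(q + q') (2 q)]. *)
Lemma cweight_le w q q' : digits w -> 0 < q -> 0 <= q' ->
  cweight q q' w <= (2 ^+ size w)^-1 / (q * (q + q')).
Proof.
elim: w q q' => [|a w IH] q q' /=.
  by move=> _ q0 q'0; rewrite cweight_nil expr0 invr1 mul1r.
move=> /andP[a0 dw] q0 q'0; rewrite cweight_cons //.
have a1 : 1 <= a%:R :> R by rewrite ler1n.
have qa : q <= q * a%:R by rewrite ler_peMr // ltW.
apply: le_trans (IH _ _ dw _ _) _; [lra | lra|].
have -> : (2 ^+ (size w).+1)^-1 / (q * (q + q')) =
  (2 ^+ size w)^-1 * (2 * (q * (q + q')))^-1 :> R.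
  by rewrite exprS !invfM; ring.
apply: ler_wpM2l; first by rewrite invr_ge0 exprn_ge0.
rewrite lef_pV2 ?posrE; [nra|nra|nra].
Qed.

(** Words with digits at most [m] keep a proportion [1 - 2 / (m + 1)] of the total
    weight per digit: the weights of the one-digit extensions telescope. *)
Lemma sum_cweight m j q q' : (0 < m)%N -> 0 < q -> 0 <= q' <= q ->
  (1 - 2 / m.+1%:R) ^+ j / (q * (q + q')) <= \sum_(w <- words m j) cweight q q' w.
Proof.
move=> m0; have m1 : 2 <= m.+1%:R :> R by rewrite ler_nat.
set th : R := 1 - _; have th0 : 0 <= th.
  by rewrite subr_ge0 ler_pdivrMr ?mul1r //; lra.
elim: j q q' => [|j IH] q q' q0 /andP[q'0 q'q] /=.
  by rewrite big_seq1 cweight_nil expr0 mul1r.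
rewrite big_allpairs_dep /=.
pose u (a : nat) : R := - (q * (q * a%:R + q'))^-1.
apply: le_trans (_ : th ^+ j * \sum_(1 <= a < m.+1) (u a.+1 - u a) <= _); last first.
  rewrite mulr_sumr /index_iota subSS subn0 big_seq [leRHS]big_seq.
  apply: ler_sum => a; rewrite mem_iota => /andP[a0 _].
  have a1 : 1 <= a%:R :> R by rewrite ler1n.
  have qa : q <= q * a%:R by rewrite ler_peMr // ltW.
  under eq_bigr do rewrite cweight_cons //.
  apply: le_trans (IH _ _ _ _); [|lra|by apply/andP; split; lra].
  (* The two sides agree: this is the partial fraction that telescopes. *)
  rewrite le_eqVlt; apply/orP; left; apply/eqP; congr (_ * _).
  rewrite /u -natr1; field.
  by do ?[apply/andP; split]; apply/lt0r_neq0; nra.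
rewrite telescope_sumr // exprSr -mulrA; apply: ler_wpM2l; first exact: exprn_ge0.
have m1' : 0 < m.+1%:R :> R by lra.
rewrite /u /th mulr1 opprK -subr_ge0.
move: (m.+1%:R : R) m1 m1' => M m1 m1'.
have h1 : 0 < q * M + q' by nra.
have h2 : 0 < q + q' by lra.
have -> : - (q * (q * M + q'))^-1 + (q * (q + q'))^-1 - (1 - 2 / M) / (q * (q + q')) =
   (q * M + 2 * q' - M * q') / (q * (q + q') * M * (q * M + q')).
  by field; do ?[apply/andP; split]; apply/lt0r_neq0.
by apply: divr_ge0; [nra | apply: mulr_ge0; nra].
Qed.

(** The minimum and the maximum are there because the order of the two end points
    depends on the parity of the length of the word. *)
Definition cylinder w : set R :=
  `]Num.min (cfrac w 0) (cfrac w 1), Num.max (cfrac w 0) (cfrac w 1)[%classic.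

Lemma cylinderP w z : digits w -> cylinder w z ->
  exists2 u, 0 < u < 1 & z = cfrac w u.
Proof.
rewrite /cylinder /= in_itv /=.
elim: w z => [|a w IH] z /=.
  by rewrite minEle maxEle ler01 => _ h; exists z.
move=> /andP[a0 dw].
have x0 := cfrac_ge0 w (lexx 0); have y0 := cfrac_ge0 w ler01.
have a1 : 1 <= a%:R :> R by rewrite ler1n.
move=> h.
have key : Num.min (cfrac w 0) (cfrac w 1) < z^-1 - a%:R < Num.max (cfrac w 0) (cfrac w 1).
  move: (cfrac w 0) (cfrac w 1) x0 y0 h {IH} => x y x0 y0.
  have hx : 0 < a%:R + x by lra.
  have hy : 0 < a%:R + y by lra.
  rewrite gt_min lt_max gt_min lt_max => /andP[h1 h2].
  have z0 : 0 < z.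
    by case/orP: h1 => h1; apply: lt_trans h1; rewrite invr_gt0.
  have inv t : 0 < t -> (t^-1 < z) = (z^-1 < t).
    by move=> t0; rewrite -[in RHS](invrK t) ltf_pV2 // posrE ?invr_gt0.
  have inv' t : 0 < t -> (z < t^-1) = (t < z^-1).
    by move=> t0; rewrite -[in RHS](invrK t) ltf_pV2 // posrE ?invr_gt0.
  move: h1 h2; rewrite !inv // !inv' // => h1 h2.
  by apply/andP; split; lra.
have [u u01 e] := IH _ dw key; exists u => //.
by rewrite -e addrC subrK invrK.
Qed.

Lemma cylinder_inj w w' z : digits w -> digits w' -> size w = size w' ->
  cylinder w z -> cylinder w' z -> w = w'.
Proof.
move=> dw dw' sw /(cylinderP dw)[u u01 ->] /(cylinderP dw')[u' u'01].
elim: w w' dw dw' sw => [|a w IH] [|a' w'] //= /andP[a0 dw] /andP[a'0 dw'] [sw].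
move=> /invr_inj; have /andP[c0 c1] := cfrac_oo dw u01.
have /andP[c'0 c'1] := cfrac_oo dw' u'01 => e.
have aa : a = a'.
  apply/eqP; rewrite eqn_leq -[(a <= _)%N]ltnS -[(a' <= _)%N]ltnS.
    rewrite -(ltr_nat R) -(ltr_nat R a') -!natr1.
  by apply/andP; split; lra.
by rewrite -aa; congr cons; apply: IH => //; move: e; rewrite aa => /addrI.
Qed.

Lemma cylinder_near w z : cylinder w z ->
  `|z - cfrac w 0| <= `|cfrac w 1 - cfrac w 0|.
Proof.
rewrite /cylinder /= in_itv /= gt_min lt_max => /andP[h1 h2].
have [h|h] := lerP (cfrac w 0) (cfrac w 1).
  by rewrite !ger0_norm; lra.
by rewrite !ler0_norm; lra.
Qed.

Lemma measure_cylinder w :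
  lebesgue_measure (cylinder w) = `|cfrac w 1 - cfrac w 0|%:E.
Proof.
rewrite /cylinder lebesgue_measure_itv /= lte_fin.
have [h|h] := ltP (cfrac w 0) (cfrac w 1).
  by rewrite gtr0_norm ?subr_gt0 // h EFinB.
have [h'|] := ltP (cfrac w 1) (cfrac w 0).
  by rewrite distrC gtr0_norm ?subr_gt0 // EFinB.
by move=> h'; rewrite (le_anti (introT andP (conj h h'))) subrr normr0.
Qed.

(** Distinct words have disjoint cylinders, so the cylinders inside an interval
    have total length at most its length. *)
Lemma sum_cylinders m j (L : seq (seq nat)) p q : p <= q ->
  {subset L <= words m j} -> uniq L ->
  (forall w, w \in L -> cylinder w `<=` `[p, q]) ->
  \sum_(w <- L) `|cfrac w 1 - cfrac w 0| <= q - p.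
Proof.
move=> pq LW uL sub.
pose U := \big[setU/set0]_(w <- L) cylinder w.
have mC w : measurable (cylinder w) by exact: measurable_itv.
have mU : lebesgue_measure U = (\sum_(w <- L) `|cfrac w 1 - cfrac w 0|)%:E.
  rewrite /U; elim: L LW uL {sub U} => [|w L IH] LW /=.
    by rewrite !big_nil measure0.
  move=> /andP[wL uL]; rewrite !big_cons measureU //.
  - rewrite EFinD; congr (_ + _)%E; first exact: measure_cylinder.
    by apply: IH => // v vL; apply: LW; rewrite inE vL orbT.
  - exact: mC.
  - by apply: bigsetU_measurable => *; exact: mC.
  - apply/seteqP; split => // z [zw]; rewrite -bigcup_seq => -[v /= vL zv].
    have vW : v \in words m j by apply: LW; rewrite inE vL orbT.
    have wW : w \in words m j by apply: LW; rewrite inE eqxx.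
    have [sv dv _] := wordsP vW; have [sw dw _] := wordsP wW.
    have e : w = v by apply: (cylinder_inj dw dv _ zw zv); rewrite sw sv.
    by move: wL; rewrite e vL.
rewrite -lee_fin -mU.
have -> : (q - p)%:E = lebesgue_measure `[p, q]%classic.
  rewrite lebesgue_measure_itv /= lte_fin.
  case: ltP => [_|qp]; first by rewrite EFinB.
  by rewrite (le_anti (introT andP (conj pq qp))) subrr.
apply: le_measure; rewrite ?inE.
- by apply: bigsetU_measurable => *; exact: mC.
- exact: measurable_itv.
- by rewrite /U -bigcup_seq => z [w /= wL zw]; exact: (sub w wL).
Qed.

Lemma sum_cylinder_lengths m j : (0 < m)%N -> (4 * j <= m)%N ->
  2^-1 <= \sum_(w <- words m j) `|cfrac w 1 - cfrac w 0|.
Proof.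
move=> m0 jm.
have -> : \sum_(w <- words m j) `|cfrac w 1 - cfrac w 0| =
          \sum_(w <- words m j) cweight 1 0 w.
  by apply: eq_bigr => w _; rewrite /cweight !mul0r addr0 mulr1 divr1.
have h01 : (0 : R) <= (0 : R) <= (1 : R) by rewrite lexx ler01.
apply: le_trans (sum_cweight j m0 ltr01 h01).
rewrite addr0 mulr1 divr1.
have m1 : 2 <= m.+1%:R :> R by rewrite ler_nat.
have bern x i : 0 <= x <= 1 -> 1 - i%:R * x <= (1 - x) ^+ i.
  move=> /andP[x0 x1]; elim: i => [|i IH]; first by rewrite mul0r subr0 expr0.
  have x1' : 0 <= 1 - x by lra.
  rewrite exprS -natr1; apply: le_trans (ler_wpM2l x1' IH).
  have : 0 <= i%:R :> R by [].
  by move: (i%:R : R) => y; nra.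
apply: le_trans (bern _ _ _); last first.
  by rewrite divr_ge0 ?ler_pdivrMr ?mul1r //=; lra.
rewrite mulrA -subr_ge0.
have : 4 * j%:R <= m%:R :> R by rewrite -natrM ler_nat.
rewrite -(natr1 m) in m1 *; move: (j%:R : R) (m%:R : R) m1 => x y y1 xy.
have -> : 1 - x * 2 / (y + 1) - 2^-1 = ((y + 1) / 2 - x * 2) / (y + 1).
  by field; apply/lt0r_neq0; lra.
by apply: divr_ge0; lra.
Qed.

Section ApproximatelyClosed.
Variables (Q : set R) (s : R).
Hypothesis Q0 : Q 0.
Hypothesis Q01 : forall x, Q x -> 0 <= x <= 1.
Hypothesis Qshift : forall x, Q x -> exists2 y, Q y & `|y - x / (1 + x)| <= s.
Hypothesis Qinv : forall x, Q x -> exists2 y, Q y & `|y - (1 + x)^-1| <= s.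

(** Since [1 / (a + t)] comes from [1 / (1 + t)] by [a - 1] applications of
    [x / (1 + x)], and neither map expands distances on the positive axis, every
    finite continued fraction is near [Q], at the price of one [s] per unit of
    digit sum. *)
Lemma near_cfrac w : digits w ->
  exists2 x, Q x & `|x - cfrac w 0| <= (sumn w)%:R * s.
Proof.
elim: w => [|a w IH] /=; first by exists 0 => //; rewrite subr0 normr0 mul0r.
move=> /andP[a0 /IH[x Qx xw]].
have c0 := cfrac_ge0 w (lexx 0).
case: a a0 => // a _.
have contr y z : 0 <= y -> 0 <= z -> `|y - z| / ((1 + y) * (1 + z)) <= `|y - z|.
  move=> y0 z0; rewrite ler_pdivrMr; last by nra.
  by rewrite ler_peMr //; nra.
elim: a => [|a [y Qy IHa]].
  have [y Qy yx] := Qinv Qx; exists y => //.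
  have /andP[x0 _] := Q01 Qx.
  have -> : y - (1%:R + cfrac w 0)^-1 = (y - (1 + x)^-1) +
      ((1 + x)^-1 - (1 + cfrac w 0)^-1) by ring.
  apply: le_trans (ler_normD _ _) _.
  have -> : (1 + x)^-1 - (1 + cfrac w 0)^-1 =
      - (x - cfrac w 0) / ((1 + x) * (1 + cfrac w 0)).
    by field; apply/andP; split; apply/lt0r_neq0; lra.
  rewrite normrM normrN [X in _ * X]ger0_norm; last by rewrite invr_ge0; nra.
  have := contr _ _ x0 c0.
  by rewrite add1n -natr1 mulrDl mul1r; lra.
have [z Qz zy] := Qshift Qy; exists z => //.
have /andP[y0 _] := Q01 Qy.
set b := (a.+1%:R + cfrac w 0)^-1 in IHa.
have a1 : 1 <= a.+1%:R :> R by rewrite ler1n.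
have b0 : 0 <= b by rewrite invr_ge0; lra.
have -> : (a.+2%:R + cfrac w 0)^-1 = b / (1 + b).
  rewrite /b -(natr1 a.+1); move: (a.+1%:R : R) a1 => A a1.
  by field; do ?[apply/andP; split]; apply/lt0r_neq0; lra.
have -> : z - b / (1 + b) = (z - y / (1 + y)) + (y / (1 + y) - b / (1 + b)) by ring.
apply: le_trans (ler_normD _ _) _.
have -> : y / (1 + y) - b / (1 + b) = (y - b) / ((1 + y) * (1 + b)).
  by field; apply/andP; split; apply/lt0r_neq0; lra.
rewrite normrM [X in _ + _ * X <= _]ger0_norm; last by rewrite invr_ge0; nra.
have := contr _ _ y0 b0.
by rewrite addSn -natr1 mulrDl mul1r; lra.
Qed.

(** A set closed up to an error [s] under the two inverse branches of the Farey
    map carries a discrete measure of mass at least [1 / 2] that is almost dominated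
    by Lebesgue measure.  The map [x / (1 + x)] has a neutral fixed point, so such
    a set may have gaps much longer than [s]; but the words of [j] digits at most
    [4 * j] have cylinders that fill half of the unit interval, and they produce errors
    only linear in the digit sum. *)
Lemma farey_measure m j : (0 < m)%N -> (4 * j <= m)%N -> (2 ^+ j)^-1 <= s ->
  exists L : seq (R * R), [/\ forall x : R * R, x \in L -> Q x.1 /\ 0 <= x.2,
    2^-1 <= \sum_(x <- L) x.2 &
    forall p q, p <= q ->
      \sum_(x <- L | p <= x.1 <= q) x.2 <= q - p + 2 * ((j * m + 1)%:R * s)].
Proof.
move=> m0 jm sj.
have s0 : 0 <= s by apply: le_trans sj; rewrite invr_ge0 exprn_ge0.
have near w : exists x, digits w -> Q x /\ `|x - cfrac w 0| <= (sumn w)%:R * s.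
  have [/near_cfrac[x Qx xw]|_] := boolP (digits w); last by exists 0.
  by exists x.
have /choice[f fP] := near.
exists [seq (f w, `|cfrac w 1 - cfrac w 0|) | w <- words m j]; split.
- move=> x /mapP[w wW ->] /=; have [_ dw _] := wordsP wW.
  by have [] := fP _ dw.
- by rewrite big_map /=; exact: sum_cylinder_lengths.
move=> p q pq; rewrite big_map /=.
set e := (j * m + 1)%:R * s.
have e0 : 0 <= e by exact: mulr_ge0.
have -> : q - p + 2 * e = (q + e) - (p - e) by ring.
rewrite -big_filter; apply: (@sum_cylinders m j); first lra.
- by move=> w; rewrite mem_filter => /andP[].
- by rewrite filter_uniq // uniq_words.
move=> w; rewrite mem_filter => /andP[/andP[pf fq] wW] z zw.
have [sw dw nw] := wordsP wW.
have [_ fw] := fP _ dw.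
have h1 := cylinder_near zw.
have h01 : (0 : R) <= (0 : R) <= (1 : R) by rewrite lexx ler01.
have h2 : `|cfrac w 1 - cfrac w 0| <= s.
  have := cweight_le dw ltr01 (lexx 0).
  by rewrite /cweight !mul0r !addr0 !mulr1 !divr1 sw => /le_trans; apply.
have h3 : (sumn w)%:R * s <= (j * m)%:R * s by rewrite ler_wpM2r // ler_nat.
have ee : e = (j * m)%:R * s + s by rewrite /e natrD mulrDl mul1r.
rewrite /= in_itv /=.
have := ler_norm (z - cfrac w 0); have := ler_norm (cfrac w 0 - z).
have := ler_norm (f w - cfrac w 0); have := ler_norm (cfrac w 0 - f w).
rewrite (distrC (cfrac w 0) z) (distrC (cfrac w 0) (f w)) => *.
by apply/andP; split; lra.
Qed.

End ApproximatelyClosed.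
End ContinuedFractions.

(** * Collisions averaged over a measure of parameters *)

Section DenseQuotients.
Local Open Scope fset_scope.
Local Open Scope ring_scope.
Variable R : realType.

Lemma powR_scale (sigma c t : R) : 0 < sigma < 1 -> 1 <= c -> 0 <= t ->
  (c * t) `^ sigma <= c * t `^ sigma.
Proof.
move=> /andP[s0 s1] c1 t0; have c0 := le_trans ler01 c1.
rewrite powRM // ler_wpM2r ?powR_ge0 // -[leRHS]powRr1 //.
by apply: ler_powR => //; exact: ltW.
Qed.

(** The exponent [2 * sigma - 1] can have either sign, so one of the two ends of
    the range of [t] dominates. *)
Lemma powR_endpoints (sigma r t : R) : 0 < sigma < 1 -> 1 <= t -> t <= r ->
  (t `^ sigma) ^+ 2 / t <= 1 + (r `^ sigma) ^+ 2 / r.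
Proof.
move=> /andP[s0 s1] t1 tr.
have t0 : 0 < t by lra.
have r0 : 0 < r by lra.
have e x : 0 < x -> (x `^ sigma) ^+ 2 / x = x `^ (2 * sigma - 1).
  move=> x0; have -> : (x `^ sigma) ^+ 2 = x `^ (2 * sigma).
    by rewrite -powR_mulrn ?powR_ge0 // -powRrM mulrC.
  by rewrite powRB ?powRr1 ?(ltW x0) // (gt_eqF x0) implybT.
rewrite !e //.
have [h|h] := lerP (2 * sigma) 1.
  apply: le_trans (_ : 1 <= _); last by rewrite lerDl powR_ge0.
  have h' : 2 * sigma - 1 <= 0 by lra.
  by apply: le_trans (ler_powR t1 h') _; rewrite powRr0.
apply: le_trans (_ : r `^ (2 * sigma - 1) <= _); last by rewrite lerDr.
by apply: ge0_ler_powR; rewrite ?nnegrE; lra.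
Qed.

Section Energy.
Variables (n sigma D eps r : R) (A : {fset int}) (L : nat) (M : seq (R * R)).
Hypothesis sigma01 : 0 < sigma < 1.
Hypothesis A_range : forall k, k \in A -> n <= k%:~R <= 2 * n.
Hypothesis D0 : 0 <= D.
Hypothesis nonconc : forall c l : R, 1 <= l ->
  #|` [fset k in A | `|k%:~R - c| <= l]|%:R <= D * l `^ sigma.
Hypothesis M01 : forall x : R * R, x \in M -> 0 <= x.1 <= 1 /\ 0 <= x.2.
Hypothesis Mleb : forall p q, p <= q ->
  \sum_(x <- M | p <= x.1 <= q) x.2 <= q - p + eps.
Hypothesis r1 : 1 <= r.
Hypothesis rn : r <= n.
Hypothesis nL : n <= 2 ^+ L.

Let rho := 4 * n / r.

(** In the application [x = e / f] with [f >= r], and collisions of the values of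
    [e y + f x] up to an error [4 n] become collisions up to [rho] after division by
    [f]. *)
Definition collide (x : R) (p q : int * int) : bool :=
  `|(p.2%:~R - q.2%:~R) + x * (p.1%:~R - q.1%:~R)| <= rho.

Let close k (p q : int * int) : bool :=
  [&& `|q.1%:~R - p.1%:~R| <= 2 ^+ k * rho,
      `|q.2%:~R - p.2%:~R| <= 2 * (2 ^+ k * rho) & 2 ^+ k * rho <= 4 * n].

Let n0 : 0 < n. Proof. exact: lt_le_trans (lt_le_trans ltr01 r1) rn. Qed.
Let r0 : 0 < r. Proof. exact: lt_le_trans ltr01 r1. Qed.
Let rho4 : 4 <= rho. Proof. by rewrite /rho ler_pdivlMr // ler_pM2l. Qed.
Let rho0 : 0 < rho. Proof. by apply: lt_le_trans rho4. Qed.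
Let rho4n : rho <= 4 * n.
Proof. by rewrite /rho ler_pdivrMr // ler_peMr // mulr_ge0 // ltW. Qed.

Lemma eps_ge0 : 0 <= eps.
Proof.
have := Mleb (lexx 0); rewrite subrr add0r; apply: le_trans.
rewrite big_seq_cond; apply: sumr_ge0 => x /andP[xM _].
by have [] := M01 xM.
Qed.

(** For two given points of [A * A] whose first coordinates are at distance [d],
    the parameters [x] at which they collide fill an interval of length
    [2 * rho / d]. *)
Lemma collision_mass (P : pred (R * R)) p q : p \in A `*` A -> q \in A `*` A ->
  \sum_(x <- M | P x) x.2 * (collide x.1 p q)%:R <=
  \sum_(k < L.+1) (close k p q)%:R * (4 / 2 ^+ k + eps).
Proof.
rewrite !in_fsetM => /andP[p1 p2] /andP[q1 q2].
have e0 := eps_ge0.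
have n0' := n0; have rho4' := rho4; have rho0' := rho0; have rho4n' := rho4n.
set d := `|q.1%:~R - p.1%:~R| : R.
have dn : d <= n.
  have /andP[? ?] := A_range p1; have /andP[? ?] := A_range q1.
  by rewrite /d ler_norml; apply/andP; split; lra.
have dL : d <= 2 ^+ L * rho.
  apply: le_trans dn _; apply: le_trans nL _.
  by rewrite ler_peMr ?exprn_ge0 //; lra.
have [k [kL dk hk]] := dyadic_index dL.
have terms i : 0 <= (close i p q)%:R * (4 / 2 ^+ i + eps).
  by rewrite mulr_ge0 // addr_ge0 // divr_ge0 // exprn_ge0.
have kL' : (k < L.+1)%N by [].
have Lk : 2 ^+ k * rho <= 4 * n.
  by case: hk => [->|h]; [rewrite expr0 mul1r | lra].
have x2 x : x \in M -> 0 <= x.2 by case/M01.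
(* Since [x.1] is at most [1], a second difference much larger than the first
   excludes every collision. *)
have [far|near] := ltP (2 * (2 ^+ k * rho)) `|q.2%:~R - p.2%:~R|.
  rewrite big_seq_cond big1; first by apply: sumr_ge0.
  move=> x /andP[xM _]; suff -> : collide x.1 p q = false by rewrite mulr0.
  apply/negbTE; rewrite -ltNge.
  have [/andP[x0 x1] _] := M01 xM.
  have h : `|x.1 * (p.1%:~R - q.1%:~R)| <= d.
    by rewrite normrM ger0_norm // distrC ler_piMl.
  have := lerB_normD (p.2%:~R - q.2%:~R) (x.1 * (p.1%:~R - q.1%:~R)).
  rewrite (distrC p.2%:~R) => h2.
  apply: lt_le_trans h2; rewrite ltrBrDr.
  have rk : rho <= 2 ^+ k * rho by rewrite ler_peMl ?exprn_ege1 ?ler1n // ltW.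
  by apply: le_lt_trans far; lra.
rewrite (bigD1 (Ordinal kL')) //= {1}/close dk near Lk mul1r.
apply: le_trans (_ : 4 / 2 ^+ k + eps <= _); last first.
  by rewrite lerDl; apply: sumr_ge0.
have mono (Q : pred (R * R)) : (forall x, x \in M -> collide x.1 p q -> Q x) ->
    \sum_(x <- M | P x) x.2 * (collide x.1 p q)%:R <= \sum_(x <- M | Q x) x.2.
  move=> sub; rewrite [leRHS]big_mkcond [leLHS]big_mkcond big_seq [leRHS]big_seq.
  apply: ler_sum => x xM; have := sub x xM.
  have x20 := x2 x xM.
  case: (P x); case: (collide _ _ _) => //=; rewrite ?mulr1 ?mulr0.
  - by move=> ->.
  - by move=> _; case: ifP.
  - by move=> ->.
  - by move=> _; case: ifP.
case: hk => [k0|dk'].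
  apply: le_trans (mono (fun x => 0 <= x.1 <= 1) _) _.
    by move=> x /M01[].
  apply: le_trans (Mleb ler01) _; rewrite k0 expr0 divr1 lerD2r; lra.
have d0 : 0 < d.
  have : 0 < 2 ^+ k * rho by rewrite mulr_gt0 // exprn_gt0.
  by lra.
set u := p.1%:~R - q.1%:~R : R.
have du : d = `|u| by rewrite /d /u distrC.
have u0 : u != 0 by rewrite -normr_gt0 -du.
set c := - (p.2%:~R - q.2%:~R) / u.
apply: le_trans (mono (fun x => c - rho / d <= x.1 <= c + rho / d) _) _.
  move=> x xM; rewrite /collide -/u => h.
  have : `|x.1 - c| <= rho / d.
    rewrite ler_pdivlMr // du -normrM (_ : (x.1 - c) * u = (p.2%:~R - q.2%:~R) + x.1 * u) //.
    by rewrite /c; field.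
  by rewrite ler_norml => /andP[? ?]; apply/andP; split; lra.
have rd0 : 0 <= rho / d by rewrite divr_ge0 // ltW.
have cc : c - rho / d <= c + rho / d by lra.
apply: le_trans (Mleb cc) _; rewrite lerD2r.
have -> : c + rho / d - (c - rho / d) = 2 * rho / d by ring.
have e2 : 0 < 2 ^+ k :> R by exact: exprn_gt0.
rewrite ler_pdivrMr // mulrAC ler_pdivlMr //.
by rewrite -mulrA [rho * _]mulrC; lra.
Qed.

Lemma card_close k p :
  \sum_(q <- A `*` A) (close k p q)%:R <=
    (if 2 ^+ k * rho <= 4 * n then 2 * D ^+ 2 * ((2 ^+ k * rho) `^ sigma) ^+ 2 else 0).
Proof.
rewrite -natr_sum -card_fset_sumb.
have [Lk|Lk] := boolP (2 ^+ k * rho <= 4 * n); last first.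
  rewrite (_ : [fset q in _ | _] = fset0) ?cardfs0 //.
  by apply/fsetP => q; rewrite !inE /close /= (negbTE Lk) !andbF.
set l := 2 ^+ k * rho.
have l1 : 1 <= l.
  have e1 : 1 <= 2 ^+ k :> R by rewrite exprn_ege1 ?ler1n.
  apply: le_trans e1 _; rewrite ler_peMr ?exprn_ge0 //.
  by apply: le_trans rho4; rewrite ler1n.
have l2 : 1 <= 2 * l by lra.
apply: le_trans (_ : #|` [fset k in A | `|k%:~R - p.1%:~R| <= l] `*`
  [fset k in A | `|k%:~R - p.2%:~R| <= 2 * l]|%:R <= _).
  rewrite ler_nat; apply: fsubset_leq_card; apply/fsubsetP => q.
  by rewrite !inE /close /= => /andP[/andP[-> ->] /and3P[-> -> _]].
rewrite card_fsetM natrM.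
apply: le_trans (ler_pM _ _ (nonconc p.1%:~R l1) (nonconc p.2%:~R l2)) _ => //.
have l0 : 0 <= l by lra.
have c2 : 1 <= 2 :> R by lra.
have := powR_scale sigma01 c2 l0.
have := powR_ge0 l sigma.
move: (l `^ sigma) ((2 * l) `^ sigma) => x y x0 yx.
have -> : 2 * D ^+ 2 * x ^+ 2 = D * x * (D * (2 * x)) by ring.
apply: ler_wpM2l; first exact: mulr_ge0.
exact: ler_wpM2l.
Qed.

(** Averaging over [x]: the dyadic scales of the first difference contribute either
    at the smallest scale [rho], or at the largest one, or through [eps]. *)
Lemma energy_upper (P : pred (R * R)) (N := #|` A|%:R : R) (a := n `^ sigma)
    (u := r `^ sigma) :
  u * (\sum_(x <- M | P x) x.2 *
     \sum_(p <- A `*` A) \sum_(q <- A `*` A) (collide x.1 p q)%:R) <=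
  L.+1%:R * (2 ^+ 9 * D ^+ 2 * N ^+ 2 * a ^+ 2 * (u^-1 + u / r + a * eps)).
Proof.
have e0 := eps_ge0.
have u0 : 0 < u by exact: powR_gt0.
have a0 : 0 <= a by exact: powR_ge0.
have ua : u <= a.
  by apply: ge0_ler_powR; rewrite ?nnegrE ?(ltW r0) ?(ltW n0) //; case/andP: sigma01 => /ltW.
set V := u^-1 + u / r + a * eps.
have V0 : 0 <= V.
  rewrite !addr_ge0 ?mulr_ge0 ?invr_ge0 ?(ltW u0) //; exact: ltW.
have step : \sum_(x <- M | P x) x.2 *
     \sum_(p <- A `*` A) \sum_(q <- A `*` A) (collide x.1 p q)%:R <=
   \sum_(k < L.+1) \sum_(p <- A `*` A) \sum_(q <- A `*` A)
     (close k p q)%:R * (4 / 2 ^+ k + eps).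
  under eq_bigr => x _ do (rewrite mulr_sumr; under eq_bigr => p _ do rewrite mulr_sumr).
  rewrite exchange_big /= [leRHS]exchange_big /= big_seq [leRHS]big_seq.
  apply: ler_sum => p pA; rewrite exchange_big /= [leRHS]exchange_big /=.
  rewrite big_seq [leRHS]big_seq; apply: ler_sum => q qA.
  exact: collision_mass.
apply: le_trans (ler_wpM2l (ltW u0) step) _.
rewrite mulr_sumr.
apply: le_trans (_ : \sum_(k < L.+1) (2 ^+ 9 * D ^+ 2 * N ^+ 2 * a ^+ 2 * V) <= _); last first.
  by rewrite sumr_const card_ord -[leLHS]mulr_natl lexx.
have c0 : 0 <= 2 ^+ 9 * D ^+ 2 * N ^+ 2 * a ^+ 2 :> R.
  apply: mulr_ge0; last exact: exprn_ge0.
  apply: mulr_ge0; last exact: exprn_ge0.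
  by apply: mulr_ge0; exact: exprn_ge0.
apply: ler_sum => k _.
under eq_bigr => p _ do rewrite -mulr_suml.
rewrite -mulr_suml.
have w0 : 0 <= 4 / 2 ^+ k + eps by rewrite addr_ge0 // divr_ge0 // exprn_ge0.
set l := 2 ^+ k * rho.
have NN : #|` A `*` A|%:R = N ^+ 2 by rewrite card_fsetM natrM expr2.
have cs : \sum_(p <- A `*` A) \sum_(q <- A `*` A) (close k p q)%:R <=
   N ^+ 2 * (if l <= 4 * n then 2 * D ^+ 2 * (l `^ sigma) ^+ 2 else 0).
  apply: le_trans (_ : \sum_(p <- A `*` A)
     (if l <= 4 * n then 2 * D ^+ 2 * (l `^ sigma) ^+ 2 else 0) <= _).
    by apply: ler_sum => p _; exact: card_close.
  by rewrite big_const_seq count_predT iter_addr_0 -NN [leRHS]mulr_natl lexx.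
apply: le_trans (ler_wpM2l (ltW u0) (ler_wpM2r w0 cs)) _.
move=> {cs}.
have [ln|_] := boolP (l <= 4 * n); last first.
  by rewrite mulr0 mul0r mulr0 mulr_ge0.
set t := 2 ^+ k : R in l ln w0 *.
have t1 : 1 <= t by rewrite exprn_ege1 ?ler1n.
have t0 : 0 < t by lra.
have tr : t <= r.
  rewrite -(ler_pM2r rho0) (_ : r * rho = 4 * n) //.
  by rewrite /rho mulrC divfK // gt_eqF.
have lE : l `^ sigma = t `^ sigma * rho `^ sigma by rewrite powRM // ltW.
have l4a : l `^ sigma <= 4 * a.
  have c4 : 1 <= 4 :> R by lra.
  apply: le_trans (powR_scale sigma01 c4 (ltW n0)).
  have l0 : 0 <= l by rewrite mulr_ge0 // ltW.
  have s0 : 0 <= sigma by case/andP: sigma01 => /ltW.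
  by apply: (ge0_ler_powR s0); rewrite ?nnegrE // mulr_ge0 // ltW.
have up4a : u * rho `^ sigma <= 4 * a.
  have c4 : 1 <= 4 :> R by lra.
  apply: le_trans (powR_scale sigma01 c4 (ltW n0)).
  rewrite -powRM ?(ltW r0) ?(ltW rho0) //.
  by rewrite /rho mulrC divfK // gt_eqF.
have ends := powR_endpoints sigma01 t1 tr.
rewrite -/u in ends.
have x0 := powR_ge0 t sigma; have P0 := powR_ge0 rho sigma.
move: lE l4a; move: (l `^ sigma) => y yE y4.
have N20 : 0 <= N ^+ 2 by exact: exprn_ge0.
have D20 : 0 <= D ^+ 2 by exact: exprn_ge0.
move: x0 P0 yE up4a ends; move: (t `^ sigma) (rho `^ sigma) => x Q x0 Q0 yE uQ ends.
have y0 : 0 <= y by rewrite yE mulr_ge0.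
have uQ2 : u ^+ 2 * Q ^+ 2 <= 16 * a ^+ 2.
  rewrite -exprMn (_ : 16 * a ^+ 2 = (4 * a) ^+ 2); last by ring.
  by rewrite lerXn2r ?nnegrE ?mulr_ge0 // ltW.
have y2 : y ^+ 2 <= 16 * a ^+ 2.
  rewrite (_ : 16 * a ^+ 2 = (4 * a) ^+ 2); last by ring.
  by rewrite lerXn2r ?nnegrE ?mulr_ge0.
have b1 : u * (y ^+ 2 / t) <= 16 * a ^+ 2 * (u^-1 + u / r).
  have -> : u * (y ^+ 2 / t) = (u ^+ 2 * Q ^+ 2) * (x ^+ 2 / t) * u^-1.
    by rewrite yE; field; apply/andP; split; apply/lt0r_neq0.
  have -> : 16 * a ^+ 2 * (u^-1 + u / r) = 16 * a ^+ 2 * (1 + u ^+ 2 / r) * u^-1.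
    by field; apply/andP; split; apply/lt0r_neq0 => //; exact: r0.
  rewrite ler_wpM2r ?invr_ge0 ?(ltW u0) //; apply: ler_pM => //.
    by rewrite mulr_ge0 ?exprn_ge0 // ltW.
  by rewrite divr_ge0 ?exprn_ge0 // ltW.
have b2 : u * (y ^+ 2 * eps) <= 16 * a ^+ 2 * (a * eps).
  have -> : 16 * a ^+ 2 * (a * eps) = a * (16 * a ^+ 2 * eps) by ring.
  apply: ler_pM => //; first exact: ltW.
    by rewrite mulr_ge0 // exprn_ge0.
  exact: ler_wpM2r.
have -> : u * (N ^+ 2 * (2 * D ^+ 2 * y ^+ 2) * (4 / t + eps)) =
   N ^+ 2 * D ^+ 2 * (8 * (u * (y ^+ 2 / t)) + 2 * (u * (y ^+ 2 * eps))).
  by field; exact/lt0r_neq0.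
have -> : 2 ^+ 9 * D ^+ 2 * N ^+ 2 * a ^+ 2 * V =
   N ^+ 2 * D ^+ 2 * (2 ^+ 9 * (a ^+ 2 * (u^-1 + u / r)) + 2 ^+ 9 * (a ^+ 2 * (a * eps))).
  by rewrite /V; ring.
apply: ler_wpM2l; first exact: mulr_ge0.
have a20 : 0 <= a ^+ 2 by exact: exprn_ge0.
have q1 : 0 <= a ^+ 2 * (u^-1 + u / r).
  apply: mulr_ge0 => //; rewrite addr_ge0 ?invr_ge0 ?(ltW u0) //.
  by rewrite divr_ge0 // ltW.
have q2 : 0 <= a ^+ 2 * (a * eps) by rewrite !mulr_ge0.
move: b1 b2; rewrite -!(mulrA 16).
have -> : 2 ^+ 9 = 512 :> R by rewrite -natrX.
move: q1 q2; move: (a ^+ 2 * (u^-1 + u / r)) (a ^+ 2 * (a * eps)) => ? ? *; lra.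
Qed.

End Energy.
End DenseQuotients.

(** * Dilates with large intersections *)

Section DiscreteSumProduct.
Local Open Scope fset_scope.
Local Open Scope ring_scope.
Variables (R : realType) (n : R).
Hypothesis n1 : 1 <= n.

(** Discretized dilation: with [n] the inverse of the scale, the integers [a] and
    [k] stand for [a / n] and [k / n], and [dil a k] for their product. *)
Definition dil (a k : int) : int := Num.floor (a%:~R * k%:~R / n : R).

Definition dilset (a : int) (A : {fset int}) := [fset dil a k | k in A].

Let n0 : 0 < n. Proof. exact: lt_le_trans ltr01 n1. Qed.

Lemma dil_le a k : (dil a k)%:~R <= a%:~R * k%:~R / n.
Proof. exact: ge_floor. Qed.

Lemma dil_gt a k : a%:~R * k%:~R / n < (dil a k)%:~R + 1.
Proof. by have := lt_succ_floor (a%:~R * k%:~R / n); rewrite intrD. Qed.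

Lemma dil_close a k l e : n <= a%:~R -> `|(dil a k)%:~R - (dil a l)%:~R| <= e ->
  `|k%:~R - l%:~R| <= e + 1 :> R.
Proof.
move=> na h.
have h1 := dil_le a k; have h2 := dil_gt a k.
have h3 := dil_le a l; have h4 := dil_gt a l.
have : `|(a%:~R * k%:~R / n : R) - a%:~R * l%:~R / n| <= e + 1.
  move: h; rewrite !ler_norml => /andP[? ?]; apply/andP; split; lra.
have -> : (a%:~R * k%:~R / n : R) - a%:~R * l%:~R / n = (a%:~R / n) * (k%:~R - l%:~R).
  by ring.
rewrite normrM ger0_norm; last by rewrite divr_ge0 // ltW // (lt_le_trans n0).
apply: le_trans; rewrite ler_peMl // ler_pdivlMr // mul1r //.
Qed.

Lemma dil_inj a : n <= a%:~R -> injective (dil a).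
Proof.
move=> na k l e.
have h1 := dil_le a k; have h2 := dil_gt a k.
have h3 := dil_le a l; have h4 := dil_gt a l.
have : `|(a%:~R * k%:~R / n : R) - a%:~R * l%:~R / n| < 1.
  by rewrite e in h1 h2; rewrite ltr_norml; apply/andP; split; lra.
have -> : (a%:~R * k%:~R / n : R) - a%:~R * l%:~R / n = (a%:~R / n) * (k%:~R - l%:~R).
  by ring.
rewrite normrM ger0_norm; last by rewrite divr_ge0 // ltW // (lt_le_trans n0).
move=> h.
have : `|(k - l)%:~R| < 1 :> R.
  apply: le_lt_trans h; rewrite intrB ler_peMl // ler_pdivlMr // mul1r //.
rewrite -intr_norm (ltrz1 _) => kl.
by apply/eqP; rewrite -subr_eq0 -normr_eq0 eq_le normr_ge0 andbT -ltzD1 add0r.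
Qed.

Lemma card_dilset a A : n <= a%:~R -> #|` dilset a A| = #|` A|.
Proof. by move=> na; apply: card_imfset; exact: dil_inj. Qed.

Lemma dilD a k l : dil a k + dil a l = dil a (k + l) \/
                   dil a k + dil a l = dil a (k + l) - 1.
Proof.
have h1 := dil_le a k; have h2 := dil_gt a k.
have h3 := dil_le a l; have h4 := dil_gt a l.
have h5 := dil_le a (k + l); have h6 := dil_gt a (k + l).
move: h5 h6; rewrite intrD mulrDr mulrDl => h5 h6.
have u : (dil a k + dil a l)%:~R < (dil a (k + l) + 1)%:~R :> R.
  by rewrite !intrD; lra.
have v : (dil a (k + l))%:~R < (dil a k + dil a l + 2)%:~R :> R.
  by rewrite !intrD; lra.
rewrite ltr_int in u; rewrite ltr_int in v; lia.
Qed.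

Lemma card_dilset_add a A :
  (#|` addfs (dilset a A) (dilset a A)| <= 2 * #|` addfs A A|)%N.
Proof.
pose S0 := dilset a (addfs A A); pose S1 := [fset k - 1 | k in S0].
have sub : addfs (dilset a A) (dilset a A) `<=` S0 `|` S1.
  apply/fsubsetP => _ /addfsP[_ /imfsetP[k /= kA ->] [_ /imfsetP[l /= lA ->] ->]].
  have kl : dil a (k + l) \in S0 by apply/imfsetP; exists (k + l) => //=; exact: mem_addfs.
  rewrite in_fsetU; case: (dilD a k l) => ->; first by rewrite kl.
  by apply/orP; right; apply/imfsetP; exists (dil a (k + l)).
apply: leq_trans (fsubset_leq_card sub) _.
apply: leq_trans (leq_card_fsetU _ _) _.
rewrite mul2n -addnn leq_add //; first exact: leq_imfset_card.
apply: leq_trans (leq_imfset_card _ _ _) _; exact: leq_imfset_card.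
Qed.

Section PopularDilates.
Variable A : {fset int}.
Hypothesis An : forall k, k \in A -> n <= k%:~R.

Lemma sum_collisions_dil a b : a \in A -> b \in A ->
  (\sum_(k <- A) \sum_(l <- A) (dil a k == dil b l)
     <= #|` dilset a A `&` dilset b A|)%N.
Proof.
move=> aA bA.
apply: leq_trans (_ : \sum_(k <- A) (dil a k \in dilset b A) <= _)%N.
  apply: leq_sum => k _.
  have [/imfsetP[l /= lA e]|nk] := boolP (dil a k \in dilset b A); last first.
    rewrite leqn0 big_seq big1 // => l lA; apply/eqP; rewrite eqb0.
    by apply: contra nk => /eqP ->; apply/imfsetP; exists l.
  rewrite (big_fsetD1 l) //= e eqxx big1_seq ?addn0 // => l' /andP[_].
  rewrite !inE => /andP[ll' _]; apply/eqP; rewrite eqb0.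
  by apply: contra ll' => /eqP /(dil_inj (An bA)) ->.
rewrite -card_fset_sumb; apply: (@leq_card_inj _ _ (dil a)).
  by move=> k l _ _; exact: dil_inj (An aA) k l.
move=> k; rewrite !inE /= => /andP[kA kb]; rewrite kb andbT.
by apply/imfsetP; exists k.
Qed.

(** Cauchy-Schwarz turns a small product set into many collisions [a k = b l];
    averaging over [b] and then over the dyadic sizes of the intersections of
    [a A] and [b A] gives the set [B].  Keeping the size [m] free instead of
    bounding it below by its mean is what makes the loss in [B] and the loss in
    [m] share a single factor. *)
Lemma popular_dilates L (P := [fset dil p.1 p.2 | p in A `*` A]) :
  A != fset0 -> (#|` A| < 2 ^ L)%N ->
  exists b B m, [/\ b \in A, B `<=` A, (0 < m)%N,
    forall a, a \in B -> (m <= #|` dilset a A `&` dilset b A|)%N &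
    (#|` A| ^ 3 <= #|` P| * (L * (m * #|` B|)))%N].
Proof.
move=> A0 AL; have N0 : (0 < #|` A|)%N by rewrite cardfs_gt0.
pose I a b := #|` dilset a A `&` dilset b A|.
have e4 : (#|` A| ^ 4 <= #|` P| * \sum_(b <- A) \sum_(a <- A) I a b)%N.
  have := card_collisions (fun p : int * int => dil p.1 p.2) (A `*` A).
  rewrite card_fsetM mulnn -expnM => /leq_trans; apply.
  rewrite leq_mul2l; apply/orP; right; rewrite big_fsetM /=.
  under eq_bigr => a _ do (under eq_bigr => k _ do rewrite big_fsetM /=;
    rewrite exchange_big /=).
  rewrite exchange_big /= big_seq [leqRHS]big_seq.
  apply: leq_sum => b bA; rewrite big_seq [leqRHS]big_seq.
  apply: leq_sum => a aA; exact: sum_collisions_dil.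
have sA0 : enum_fset A != [::].
  by apply: contra A0 => /eqP e; rewrite -cardfs_eq0 /= e.
have [b bA hb] := exists_ge_average (fun b => \sum_(a <- A) I a b)%N sA0.
have e3 : (#|` A| ^ 3 <= #|` P| * \sum_(a <- A) I a b)%N.
  rewrite -(leq_pmul2l N0) -expnS; apply: leq_trans e4 _.
  by rewrite mulnCA leq_mul2l hb orbT.
pose Bi i := [fset a in A | (2 ^ i <= I a b)%N].
have dy : (\sum_(a <- A) I a b <= \sum_(i < L) 2 ^ i * #|` Bi i|)%N.
  have -> : (\sum_(i < L) 2 ^ i * #|` Bi i| =
      \sum_(a <- A) \sum_(i < L) 2 ^ i * (2 ^ i <= I a b))%N.
    rewrite exchange_big /=; apply: eq_bigr => i _.
    by rewrite card_fset_sumb big_distrr.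
  apply: leq_sum => a _; apply: sum_pow2.
  apply: leq_ltn_trans AL; apply: leq_trans (fsubset_leq_card (fsubsetIl _ _)) _.
  exact: leq_imfset_card.
have [L0|L0] := posnP L; first by move: AL; rewrite L0 expn0 ltnS leqNgt N0.
have sI : index_enum 'I_L != [::].
  by apply/eqP => e; have := mem_index_enum (Ordinal L0); rewrite e.
have [i _ hi] := exists_ge_average (fun i : 'I_L => 2 ^ i * #|` Bi i|)%N sI.
exists b, (Bi i), (2 ^ i)%N; split => //.
- by apply/fsubsetP => a; rewrite !inE => /andP[].
- by rewrite expn_gt0.
- by move=> a; rewrite !inE => /andP[].
apply: leq_trans e3 _; rewrite leq_mul2l; apply/orP; right.
apply: leq_trans dy _; apply: leq_trans hi _.
by rewrite -[index_enum _]enumT -cardT card_ord.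
Qed.

End PopularDilates.

(** * Linear forms with coefficients in differences of [B] *)

(** [b], [B] and [m] are those of [popular_dilates], and [nonconc] bounds the number
    of elements of [A] in an interval of radius [l]; as [A] has about
    [n `^ sigma] elements, this says that [A] is nowhere denser than a set of
    dimension [sigma]. *)
Section LinearForms.
Variables (A B : {fset int}) (b : int) (m : nat) (D sigma K : R).
Hypothesis A0 : A != fset0.
Hypothesis A_range : forall k, k \in A -> n <= k%:~R <= 2 * n.
Hypothesis bA : b \in A.
Hypothesis BA : B `<=` A.
Hypothesis popB : forall a, a \in B -> (m <= #|` dilset a A `&` dilset b A|)%N.
Hypothesis sigma01 : 0 < sigma < 1.
Hypothesis D0 : 0 <= D.
Hypothesis nonconc : forall c l : R, 1 <= l ->
  #|` [fset k in A | `|k%:~R - c| <= l]|%:R <= D * l `^ sigma.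
Hypothesis K0 : 0 <= K.
Hypothesis doubling : #|` addfs A A|%:R <= K * #|` A|%:R.

Let An k : k \in A -> n <= k%:~R. Proof. by case/A_range/andP. Qed.
Let A2n k : k \in A -> k%:~R <= 2 * n. Proof. by case/A_range/andP. Qed.

Lemma add_dilset_step Y a : a \in B ->
  (#|` addfs Y (dilset a A)| * m <=
   #|` addfs Y (dilset b A)| * (2 * #|` addfs A A|))%N.
Proof.
move=> aB; set W := dilset a A `&` dilset b A.
apply: leq_trans (_ : #|` addfs Y (dilset a A)| * #|` W| <= _)%N.
  by rewrite leq_mul2l popB ?orbT.
apply: leq_trans (sum_triangle _ _ _) _; apply: leq_mul.
  by apply: fsubset_leq_card; apply: addfsS => //; exact: fsubsetIr.
apply: leq_trans (card_dilset_add a A).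
by apply: fsubset_leq_card; apply: addfsS => //; exact: fsubsetIl.
Qed.

Lemma sub_dilset_step Y a : a \in B ->
  (#|` subfs Y (dilset a A)| * m <=
   #|` addfs Y (dilset b A)| * (2 * #|` addfs A A|))%N.
Proof.
move=> aB; set W := dilset a A `&` dilset b A.
apply: leq_trans (_ : #|` subfs Y (dilset a A)| * #|` W| <= _)%N.
  by rewrite leq_mul2l popB ?orbT.
apply: leq_trans (ruzsa_triangle _ _ _) _; apply: leq_mul.
  by apply: fsubset_leq_card; apply: addfsS => //; exact: fsubsetIr.
apply: leq_trans (card_dilset_add a A).
by apply: fsubset_leq_card; apply: addfsS => //; exact: fsubsetIl.
Qed.

(** Each of the four dilates is traded for [b A], at a price [2 |A + A| / m],
    through the common part of the two dilates. *)
Lemma card_four_dilates X b1 b2 b3 b4 (U := dilset b A) :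
  b1 \in B -> b2 \in B -> b3 \in B -> b4 \in B ->
  (#|` subfs (subfs (addfs (addfs X (dilset b1 A)) (dilset b3 A)) (dilset b2 A))
       (dilset b4 A)| * m ^ 4 <=
   #|` addfs X (addfs U (addfs U (addfs U U)))| * (2 * #|` addfs A A|) ^ 4)%N.
Proof.
move=> B1 B2 B3 B4.
have swapD Y Z : addfs (addfs Y Z) U = addfs (addfs Y U) Z.
  by rewrite -addfsA (addfsC Z) addfsA.
have swapB Y Z : addfs (subfs Y Z) U = subfs (addfs Y U) Z.
  apply/fsetP => z; apply/addfsP/subfsP.
    move=> [_ /subfsP[y yY [t tZ ->]] [u uU ->]].
    exists (y + u); first exact: mem_addfs.
    by exists t => //; rewrite addrAC.
  move=> [_ /addfsP[y yY [u uU ->]] [t tZ ->]].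
  exists (y - t); first by apply/subfsP; exists y => //; exists t.
  by exists u => //; rewrite addrAC.
set c := (2 * _)%N; set Y := addfs (addfs X _) _.
have h4 := sub_dilset_step (subfs Y (dilset b2 A)) B4.
have h2 := sub_dilset_step (addfs Y U) B2.
have h3 := add_dilset_step (addfs (addfs (addfs X (dilset b1 A)) U) U) B3.
have h1 := add_dilset_step (addfs (addfs (addfs X U) U) U) B1.
rewrite -/c -/U swapB in h4.
rewrite -/c -/U in h2 h3 h1.
have e3 : addfs (addfs Y U) U =
  addfs (addfs (addfs (addfs X (dilset b1 A)) U) U) (dilset b3 A).
  by rewrite /Y swapD [LHS]swapD.
have e1 : addfs (addfs (addfs (addfs X (dilset b1 A)) U) U) U =
  addfs (addfs (addfs (addfs X U) U) U) (dilset b1 A).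
  by rewrite (swapD X) (swapD (addfs X U)) (swapD (addfs (addfs X U) U)).
have e0 : addfs X (addfs U (addfs U (addfs U U))) =
          addfs (addfs (addfs (addfs X U) U) U) U by rewrite !addfsA.
rewrite e3 in h2; rewrite e1 in h3; rewrite e0.
move: h4 h2 h3 h1.
set x4 := #|` subfs (subfs Y _) _|; set x3 := #|` subfs _ (dilset b2 A)|.
set x2 := #|` addfs _ (dilset b3 A)|; set x1 := #|` addfs _ (dilset b1 A)|.
set x0 := #|` addfs _ U|; move: x4 x3 x2 x1 x0 => x4 x3 x2 x1 x0 h4 h2 h3 h1.
have chain x y z e : (x * m <= y * c)%N -> (y * m ^ e <= z * c ^ e)%N ->
    (x * m ^ e.+1 <= z * c ^ e.+1)%N.
  move=> h k; rewrite expnS mulnA (leq_trans (leq_mul h (leqnn (m ^ e)))) //.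
  by rewrite mulnAC expnSr mulnA leq_mul2r k orbT.
by apply: (chain _ _ _ _ h4); apply: (chain _ _ _ _ h2); apply: (chain _ _ _ _ h3);
  rewrite !expn1.
Qed.

(** A set [S] of short diameter made of values [v1 + v3 - v2 - v4], with [vi] in the
    dilate [bi A], is smaller than the sum of the four dilates by the factor that
    an interval of that length costs: adding to [S] a subset [X] of [b A] multiplies
    its size by the size of [X] over that of its densest piece at this scale. *)
Lemma card_linear_form S b1 b2 b3 b4 l :
  b1 \in B -> b2 \in B -> b3 \in B -> b4 \in B -> 1 <= l ->
  (forall s, s \in S -> exists v1 v2 v3 v4, [/\ v1 \in dilset b1 A,
     v2 \in dilset b2 A, v3 \in dilset b3 A, v4 \in dilset b4 A &
     s = v1 + v3 - v2 - v4]) ->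
  (forall s t, s \in S -> t \in S -> `|s%:~R - t%:~R| <= l :> R) ->
  #|` S|%:R * m%:R ^+ 4 <=
    2 ^+ 8 * K ^+ 8 * #|` A|%:R ^+ 4 * (D * (l + 1) `^ sigma).
Proof.
move=> B1 B2 B3 B4 l1 Sform Sdiam.
set U := dilset b A.
have U0 : U != fset0 by rewrite -cardfs_gt0 (card_dilset _ (An bA)) cardfs_gt0.
have [X [XU X0 plX]] := plunnecke4 U U0.
have four := card_four_dilates X B1 B2 B3 B4.
set G := subfs _ _ in four.
set r := D * (l + 1) `^ sigma.
have SX : #|` S|%:R * #|` X|%:R <= #|` G|%:R * r.
  rewrite -natrM -card_fsetM.
  apply: le_trans (ler_card_fibres (f := fun p : int * int => p.1 + p.2)
     (r := r) _) _; last first.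
    rewrite ler_wpM2r //; first by rewrite mulr_ge0 ?powR_ge0.
    rewrite ler_nat; apply: fsubset_leq_card.
    apply/fsubsetP => _ /imfsetP[[s x] /= sx ->].
    move: sx; rewrite in_fsetM /= => /andP[sS xX].
    have [v1 [v2 [v3 [v4 [V1 V2 V3 V4 ->]]]]] := Sform s sS.
    apply/subfsP; exists (x + v1 + v3 - v2); last by exists v4 => //; ring.
    apply/subfsP; exists (x + v1 + v3); last by exists v2.
    by apply: mem_addfs => //; exact: mem_addfs.
  move=> [s x]; rewrite in_fsetM /= => /andP[sS xX].
  have /imfsetP[k0 /= k0A xk0] := fsubsetP XU _ xX.
  apply: le_trans (nonconc k0%:~R (_ : 1 <= l + 1)); last lra.
  rewrite ler_nat.
  have pre y : exists k, y \in X -> k \in A /\ y = dil b k.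
    have [/(fsubsetP XU)/imfsetP[k /= kA ->]|_] := boolP (y \in X); last by exists 0.
    by exists k.
  have /choice[g gP] := pre.
  apply: (@leq_card_inj _ _ (fun p : int * int => g p.2)).
    move=> [s' x'] [s'' x'']; rewrite !inE /= => /andP[/andP[_ x'X] /eqP e'].
    move=> /andP[/andP[_ x''X] /eqP e''] gg.
    have [_ x'g] := gP _ x'X; have [_ x''g] := gP _ x''X.
    have xx : x' = x'' by rewrite x'g x''g gg.
    by move: e'; rewrite -e'' xx => /addIr ->.
  move=> [s' x']; rewrite !inE /= => /andP[/andP[s'S x'X] /eqP e'].
  have [gA x'g] := gP _ x'X; rewrite gA /=.
  apply: (dil_close (An bA)); rewrite -x'g -xk0.
  have -> : x'%:~R - x%:~R = s%:~R - s'%:~R :> R.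
    have -> : x' = s + x - s' by rewrite -e' addrAC subrr add0r.
    by rewrite intrB intrD; ring.
  exact: Sdiam.
have N0 : 0 < #|` A|%:R :> R by rewrite ltr0n cardfs_gt0.
have cX0 : 0 < #|` X|%:R :> R by rewrite ltr0n cardfs_gt0.
set N : R := #|` A|%:R in N0 *.
set c : R := 2 * #|` addfs A A|%:R.
have c0 : 0 <= c by rewrite mulr_ge0.
have cK : c <= 2 * K * N by rewrite -mulrA ler_wpM2l.
have r0 : 0 <= r by rewrite mulr_ge0 ?powR_ge0.
set P5 : R := #|` addfs X (addfs U (addfs U (addfs U U)))|%:R.
have P50 : 0 <= P5 by [].
have hG : #|` G|%:R * m%:R ^+ 4 <= P5 * c ^+ 4.
  have -> : c = (2 * #|` addfs A A|)%N%:R by rewrite natrM.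
  by rewrite -!natrX -!natrM ler_nat.
have hP : P5 * N ^+ 4 <= c ^+ 4 * #|` X|%:R.
  apply: le_trans (_ : #|` addfs U U|%:R ^+ 4 * #|` X|%:R <= _).
    by rewrite /N -(card_dilset A (An bA)) -!natrX -!natrM ler_nat.
  rewrite ler_wpM2r // lerXn2r ?nnegrE //.
  by rewrite /c -natrM ler_nat; exact: card_dilset_add.
set M4 : R := m%:R ^+ 4 in hG *.
have M40 : 0 <= M4 by rewrite exprn_ge0.
have N40 : 0 < N ^+ 4 by rewrite exprn_gt0.
have main : #|` S|%:R * M4 * N ^+ 4 <= c ^+ 8 * r.
  rewrite -(ler_pM2r cX0).
  apply: le_trans (_ : (#|` S|%:R * #|` X|%:R) * (M4 * N ^+ 4) <= _).
    by rewrite le_eqVlt; apply/orP; left; apply/eqP; ring.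
  apply: le_trans (ler_wpM2r _ SX) _; first by rewrite mulr_ge0 // ltW.
  apply: le_trans (_ : (#|` G|%:R * M4) * (N ^+ 4 * r) <= _).
    by rewrite le_eqVlt; apply/orP; left; apply/eqP; ring.
  apply: le_trans (ler_wpM2r _ hG) _; first by rewrite mulr_ge0 // ltW.
  apply: le_trans (_ : (P5 * N ^+ 4) * (c ^+ 4 * r) <= _).
    by rewrite le_eqVlt; apply/orP; left; apply/eqP; ring.
  apply: le_trans (ler_wpM2r _ hP) _; first by rewrite mulr_ge0 // exprn_ge0.
  by rewrite le_eqVlt; apply/orP; left; apply/eqP; ring.
rewrite -(ler_pM2r N40); apply: le_trans main _.
apply: le_trans (_ : (2 * K * N) ^+ 8 * r <= _).
  by rewrite ler_wpM2r // lerXn2r ?nnegrE // mulr_ge0 ?mulr_ge0 // ltW.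
by rewrite le_eqVlt; apply/orP; left; apply/eqP; ring.
Qed.


(** The form [((b1 - b2) x + (b3 - b4) y) / n], up to the errors of the four
    floors. *)
Definition linear_form (b1 b2 b3 b4 : int) (p : int * int) : int :=
  dil b1 p.1 + dil b3 p.2 - dil b2 p.1 - dil b4 p.2.

Lemma linear_formP b1 b2 b3 b4 p :
  `|(linear_form b1 b2 b3 b4 p)%:~R -
    ((b1%:~R - b2%:~R) * p.1%:~R + (b3%:~R - b4%:~R) * p.2%:~R) / n| < 2.
Proof.
rewrite /linear_form !intrB intrD.
have := dil_le b1 p.1; have := dil_gt b1 p.1.
have := dil_le b2 p.1; have := dil_gt b2 p.1.
have := dil_le b3 p.2; have := dil_gt b3 p.2.
have := dil_le b4 p.2; have := dil_gt b4 p.2.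
have -> : ((b1%:~R - b2%:~R) * p.1%:~R + (b3%:~R - b4%:~R) * p.2%:~R) / n =
  b1%:~R * p.1%:~R / n - b2%:~R * p.1%:~R / n + b3%:~R * p.2%:~R / n
   - b4%:~R * p.2%:~R / n :> R by ring.
by move=> *; rewrite ltr_norml; apply/andP; split; lra.
Qed.

(** On integers of size [n] the form takes values in an interval of length about
    [F], and non-concentration then saves the factor [(F / n) `^ sigma] over the
    size of the sum of four dilates. *)
Lemma card_form_image (G : {fset int * int}) b1 b2 b3 b4 (F : R) :
  b1 \in B -> b2 \in B -> b3 \in B -> b4 \in B -> G `<=` A `*` A -> 1 <= F ->
  0 <= (b1%:~R - b2%:~R : R) <= F -> 0 <= (b3%:~R - b4%:~R : R) <= F ->
  #|` [fset linear_form b1 b2 b3 b4 p | p in G]|%:R * m%:R ^+ 4 <=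
    2 ^+ 12 * K ^+ 8 * #|` A|%:R ^+ 4 * D * F `^ sigma.
Proof.
move=> B1 B2 B3 B4 GA F1 /andP[e0 eF] /andP[f0 fF].
set S := [fset _ | _ in _].
have F0 : 0 <= F by exact: le_trans ler01 F1.
have Sform s : s \in S -> exists v1 v2 v3 v4, [/\ v1 \in dilset b1 A,
     v2 \in dilset b2 A, v3 \in dilset b3 A, v4 \in dilset b4 A &
     s = v1 + v3 - v2 - v4].
  case/imfsetP=> p /= /(fsubsetP GA); rewrite in_fsetM => /andP[p1 p2] ->.
  by exists (dil b1 p.1), (dil b2 p.1), (dil b3 p.2), (dil b4 p.2); split => //;
    rewrite in_imfset.
have Srange s : s \in S -> -2 < (s%:~R : R) < 4 * F + 2.
  case/imfsetP=> p /= /(fsubsetP GA); rewrite in_fsetM => /andP[p1 p2] ->.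
  have := linear_formP b1 b2 b3 b4 p; rewrite ltr_norml.
  set v := _ / n; have v0 : 0 <= v.
    have x1 := le_trans (ltW n0) (An p1); have x2 := le_trans (ltW n0) (An p2).
    by rewrite divr_ge0 ?(ltW n0) // addr_ge0 // mulr_ge0.
  have v4 : v <= 4 * F.
    rewrite ler_pdivrMr //.
    have h1 := A2n p1; have h2 := A2n p2.
    apply: le_trans (_ : F * (2 * n) + F * (2 * n) <= _); last lra.
    have x1 := le_trans (ltW n0) (An p1); have x2 := le_trans (ltW n0) (An p2).
    by apply: lerD; apply: ler_pM.
  by move=> /andP[? ?]; apply/andP; split; lra.
have l1 : 1 <= 4 * F + 4 by lra.
have := card_linear_form B1 B2 B3 B4 l1 Sform.
move=> /(_ _)/le_trans; apply.
  move=> s t /Srange/andP[? ?] /Srange/andP[? ?].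
  by rewrite ler_norml; apply/andP; split; lra.
have pK : 0 <= 2 ^+ 8 * K ^+ 8 * #|` A|%:R ^+ 4.
  by apply: mulr_ge0; [apply: mulr_ge0; exact: exprn_ge0 | exact: exprn_ge0].
apply: le_trans (_ : 2 ^+ 8 * K ^+ 8 * #|` A|%:R ^+ 4 * (D * (16 * F `^ sigma)) <= _).
  apply: ler_wpM2l => //; apply: ler_wpM2l => //.
  have c1 : 1 <= 16 :> R by lra.
  apply: le_trans (powR_scale sigma01 c1 F0).
  have /andP[s0 s1] := sigma01.
  by apply: ge0_ler_powR; rewrite ?nnegrE //; [exact: ltW | lra | lra | lra].
by rewrite le_eqVlt; apply/orP; left; apply/eqP; ring.
Qed.

Section QuotientSet.
Variables (L : nat) (T : R).
Hypothesis T1 : 1 <= T.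
Hypothesis N_lower : n `^ sigma <= 2 * #|` A|%:R.
Hypothesis B_large : #|` A|%:R ^+ 2 <= K * L%:R * (m%:R * #|` B|%:R).

Definition quotients : set R := [set x | exists b1 b2 b3 b4,
  [/\ b1 \in B, b2 \in B, b3 \in B & b4 \in B] /\
  T <= (b3%:~R - b4%:~R : R) /\ x = (b1%:~R - b2%:~R) / (b3%:~R - b4%:~R)].

Let N0 : 0 < #|` A|%:R :> R. Proof. by rewrite ltr0n cardfs_gt0. Qed.

Lemma cardB_gt0 : 0 < #|` B|%:R :> R.
Proof.
rewrite ltr0n lt0n; apply/eqP => e; move: B_large; rewrite e !mulr0.
by rewrite leNgt exprn_gt0.
Qed.

(** Bounds [m] from below by bounding the size of [B] by that of [A]. *)
Lemma N_le_m : #|` A|%:R <= K * L%:R * m%:R.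
Proof.
rewrite -(ler_pM2r N0) -expr2; apply: le_trans B_large _.
rewrite mulrA ler_wpM2l //; first by rewrite !mulr_ge0.
by rewrite ler_nat; exact: fsubset_leq_card.
Qed.

(** A small sumset has many coincidences [x + x0 = a + y]; [x0] is the best choice
    in the average. *)
Lemma many_sums : exists2 x0, x0 \in B &
  (#|` B| ^ 3 <= #|` addfs A A| *
     #|` [fset p in B `*` B | (p.1 - p.2 + x0)%R \in B]|)%N.
Proof.
have B0 : (0 < #|` B|)%N by rewrite -(ltr0n R); exact: cardB_gt0.
pose G x0 := [fset p in B `*` B | (p.1 - p.2 + x0)%R \in B].
have e4 : (#|` B| ^ 4 <= #|` addfs A A| * \sum_(x0 <- B) #|` G x0|)%N.
  have := card_collisions (fun p : int * int => p.1 + p.2) (B `*` B).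
  rewrite card_fsetM mulnn -expnM => /leq_trans; apply; apply: leq_mul.
    apply: fsubset_leq_card; apply/fsubsetP => z /imfsetP[p /= + ->].
    by rewrite in_fsetM => /andP[p1 p2]; apply: mem_addfs; exact: (fsubsetP BA).
  rewrite big_fsetM exchange_big /= big_seq [leqRHS]big_seq.
  apply: leq_sum => x0 x0B; rewrite card_fset_sumb big_fsetM /=.
  apply: leq_sum => x _; rewrite big_fsetM /=; apply: leq_sum => a _.
  have [yB|yB] := boolP (x - a + x0 \in B); last first.
    rewrite leqn0 big_seq big1 // => y y'; apply/eqP; rewrite eqb0.
    apply: contra yB => /eqP e.
    by have -> : x - a + x0 = y by rewrite addrAC e addrAC subrr add0r.
  rewrite (big_fsetD1 (x - a + x0)) //= big1_seq ?addr0 ?leq_b1 // => y /andP[_].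
  rewrite !inE => /andP[yy _]; apply/eqP; rewrite eqb0; apply: contra yy => /eqP e.
  by rewrite addrAC e addrAC subrr add0r.
have sB0 : enum_fset B != [::].
  by apply/eqP => e; move: B0; rewrite /= e.
have [x0 x0B h] := exists_ge_average (fun x0 => #|` G x0|) sB0.
exists x0 => //; rewrite -(leq_pmul2l B0) -expnS; apply: leq_trans e4 _.
by rewrite mulnCA leq_mul2l h orbT.
Qed.

(** If the point [f / (e + f)] were far from all the quotients, then the form
    [e x + f a] would be nearly injective on the many pairs [(x, a)] for which
    [y = x - a + x0] stays in [B]: two pairs with the same value have their [y] at
    distance less than [T], for otherwise the quotient of the differences of [x] and
    of [y] would be near [f / (e + f)].  The image would then have more elements
    than [card_form_image] allows.  The factors [F `^ sigma] of the two bounds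
    cancel. *)
Lemma quotient_near (b1 b2 b3 b4 : int) (e := b1%:~R - b2%:~R : R) (f := b3%:~R - b4%:~R : R)
    (F : R) :
  b1 \in B -> b2 \in B -> b3 \in B -> b4 \in B ->
  0 <= e <= F -> 0 <= f <= F -> F <= e + f -> T <= F -> F <= n ->
  2 ^+ 15 * K ^+ 13 * L%:R ^+ 4 * D ^+ 3 * T `^ sigma < #|` A|%:R ->
  exists2 x, quotients x & `|x - f / (e + f)| <= 4 * n / T ^+ 2.
Proof.
move=> B1 B2 B3 B4 eF fF Fef TF Fn big.
apply/not_exists2P => far; move: big; apply/negP; rewrite -leNgt.
have T0 : 0 < T by exact: lt_le_trans ltr01 T1.
have F0 : 0 < F by exact: lt_le_trans T0 TF.
have ef0 : 0 < e + f by exact: lt_le_trans F0 Fef.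
have [x0 x0B hG] := many_sums.
set G := [fset p in _ | _] in hG.
have GP p : p \in G -> [/\ p.1 \in B, p.2 \in B & p.1 - p.2 + x0 \in B].
  by rewrite !inE /= => /andP[/andP[? ?] ?].
pose y (p : int * int) := p.1 - p.2 + x0.
pose g := linear_form b1 b2 b3 b4.
have same p q : g p = g q ->
    `|(e + f) * (p.1%:~R - q.1%:~R) - f * ((y p)%:~R - (y q)%:~R)| < 4 * n.
  move=> gpq; have := linear_formP b1 b2 b3 b4 p; have := linear_formP b1 b2 b3 b4 q.
  rewrite -/g gpq -/e -/f => h1 h2.
  have : `|(e * p.1%:~R + f * p.2%:~R) / n - (e * q.1%:~R + f * q.2%:~R) / n| < 4.
    move: h1 h2; rewrite !ltr_norml => /andP[? ?] /andP[? ?].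
    by apply/andP; split; lra.
  rewrite -mulrBl normrM [X in _ * X]ger0_norm; last by rewrite invr_ge0 ltW.
  rewrite ltr_pdivrMr //; congr (`|_| < _).
  by rewrite /y !intrD !intrN; ring.
have farE x : quotients x -> 4 * n / T ^+ 2 < `|x - f / (e + f)|.
  by move=> qx; case: (far x) => // /negP; rewrite -ltNge.
(* The quotient of the differences would be within the forbidden distance. *)
have one p q : p \in G -> q \in G -> g p = g q -> (y p)%:~R - (y q)%:~R < T :> R.
  move=> pG qG gpq; rewrite ltNge; apply/negP => TY.
  have [p1 _ yp] := GP p pG; have [q1 _ yq] := GP q qG.
  have qx : quotients ((p.1%:~R - q.1%:~R) / ((y p)%:~R - (y q)%:~R)).
    by exists p.1, q.1, (y p), (y q); split.
  have := farE _ qx; apply/negP; rewrite -leNgt.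
  have := ltW (same p q gpq); move: TY.
  move: (p.1%:~R - q.1%:~R : R) ((y p)%:~R - (y q)%:~R : R) => u v Tv.
  have v0 : 0 < v by exact: lt_le_trans T0 Tv.
  have -> : u / v - f / (e + f) = ((e + f) * u - f * v) / ((e + f) * v).
    by field; apply/andP; split; apply/lt0r_neq0.
  have d0 : 0 < (e + f) * v by exact: mulr_gt0.
  rewrite normrM [X in _ -> _ * X <= _]ger0_norm; last by rewrite invr_ge0 ltW.
  move=> h; rewrite ler_pdivrMr //; apply: le_trans h _.
  rewrite mulrAC ler_pdivlMr ?exprn_gt0 // ler_wpM2l //.
    by rewrite mulr_ge0 // ltW.
  by rewrite expr2; apply: ler_pM => //; rewrite ?(ltW T0) //; lra.
set r := D * T `^ sigma * (4 * D * (n / F) `^ sigma).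
have nF : 1 <= n / F by rewrite ler_pdivlMr // mul1r.
have GA : G `<=` A `*` A.
  apply/fsubsetP => p /GP[p1 p2 _]; rewrite in_fsetM.
  by rewrite !(fsubsetP BA).
have fib p : p \in G -> #|` [fset q in G | g q == g p]|%:R <= r.
  move=> pG; have [p1 p2 yp] := GP p pG.
  set Phi := [fset q in _ | _].
  have PhiP q : q \in Phi -> q \in G /\ g q = g p.
    by rewrite !inE /= => /andP[? /eqP].
  (* A fibre meets few values of [y], and over each of them few values of [x]. *)
  apply: le_trans (ler_card_fibres (f := y) (r := 4 * D * (n / F) `^ sigma) _) _.
    move=> q /PhiP[qG gq]; have [q1 q2 yq] := GP q qG.
    apply: le_trans (_ : D * (4 * (n / F)) `^ sigma <= _); last first.
      rewrite -mulrA [leRHS]mulrCA ler_wpM2l //; apply: (powR_scale sigma01); [lra|lra].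
    apply: le_trans (nonconc q.1%:~R (_ : 1 <= 4 * (n / F))); last by lra.
    rewrite ler_nat; apply: (@leq_card_inj _ _ (fun q : int * int => q.1)).
      move=> s t; rewrite 2!inE /= => /andP[/PhiP[sG _] /eqP ys].
      rewrite 2!inE /= => /andP[/PhiP[tG _] /eqP yt] st.
      apply/eqP; rewrite -pair_eqE /pair_eq /= st eqxx /=.
      move: ys; rewrite -yt /y st => /addIr/addrI/oppr_inj ->; exact: eqxx.
    move=> s; rewrite 2!inE /= => /andP[/PhiP[sG gs] /eqP ys].
    have [s1 _ _] := GP s sG.
    rewrite !inE (fsubsetP BA) //=.
    have := same s q (etrans gs (esym gq)); rewrite ys subrr mulr0 subr0 normrM.
    rewrite (ger0_norm (ltW ef0)) mulrA ler_pdivlMr // => /ltW; apply: le_trans.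
    by rewrite mulrC ler_wpM2r.
  rewrite ler_wpM2r //; first by rewrite mulr_ge0 ?powR_ge0 // mulr_ge0.
  apply: le_trans (nonconc (y p)%:~R T1); rewrite ler_nat; apply: fsubset_leq_card.
  apply/fsubsetP => _ /imfsetP[q /= /PhiP[qG gq] ->].
  have [_ _ yq] := GP q qG; rewrite !inE (fsubsetP BA) //= ler_norml.
  have := one p q pG qG (esym gq); have := one q p qG pG gq.
  by move=> *; apply/andP; split; lra.
have hr := ler_card_fibres fib.
have fib0 : 0 <= r by rewrite !mulr_ge0 ?powR_ge0.
have F1 : 1 <= F by exact: le_trans T1 TF.
have im := card_form_image B1 B2 B3 B4 GA F1 eF fF.
rewrite -/g in im.
have hn : F `^ sigma * (n / F) `^ sigma <= 2 * #|` A|%:R.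
  rewrite -powRM ?(ltW F0) //; last by lra.
  by rewrite mulrC divfK ?lt0r_neq0.
move: hr im hn; rewrite /r.
set I : R := #|` [fset g x | x in G]|%:R.
have hG' : #|` B|%:R ^+ 3 <= K * #|` A|%:R * #|` G|%:R :> R.
  apply: le_trans (_ : #|` addfs A A|%:R * #|` G|%:R <= _); last by rewrite ler_wpM2r.
  by rewrite -natrX -natrM ler_nat.
have hm := N_le_m; have hB := B_large.
move: hG' hm hB N0.
have L0 : 0 <= L%:R :> R by [].
have B0 := ltW cardB_gt0.
have G0 : 0 <= #|` G|%:R :> R by [].
have M0 : 0 <= m%:R :> R by [].
have t0 : 0 <= T `^ sigma by exact: powR_ge0.
have u0 : 0 <= F `^ sigma by exact: powR_ge0.
have v0 : 0 <= (n / F) `^ sigma by exact: powR_ge0.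
have I0 : 0 <= I by [].
move: I I0 (#|` A|%:R : R) (#|` B|%:R : R) B0 (#|` G|%:R : R) G0 (m%:R : R) M0
  (L%:R : R) L0 (T `^ sigma) t0 (F `^ sigma) u0 ((n / F) `^ sigma) v0.
clear -K0 D0.
move=> I I0 N cB B0 cG G0 M M0 l L0 t t0 u u0 v v0 hG hm hB N0 hr im hn.
have N0' : 0 <= N := ltW N0.
have e2 i : 0 <= 2 ^+ i :> R by exact: exprn_ge0.
have s1 : cG * M ^+ 4 <= 2 ^+ 15 * K ^+ 8 * N ^+ 5 * D ^+ 3 * t.
  apply: le_trans (_ : I * M ^+ 4 * (D * t * (4 * D * v)) <= _).
    by rewrite mulrAC ler_wpM2r // exprn_ge0.
  have p1 : 0 <= D * t * (4 * D * v).
    by apply: mulr_ge0; [exact: mulr_ge0 | apply: mulr_ge0 => //; exact: mulr_ge0].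
  apply: le_trans (ler_wpM2r p1 im) _.
  have -> : 2 ^+ 12 * K ^+ 8 * N ^+ 4 * D * u * (D * t * (4 * D * v)) =
    2 ^+ 14 * (K ^+ 8 * N ^+ 4 * D ^+ 3 * t) * (u * v) by ring.
  have p2 : 0 <= K ^+ 8 * N ^+ 4 * D ^+ 3 * t.
    apply: mulr_ge0 => //; apply: mulr_ge0; last exact: exprn_ge0.
    by apply: mulr_ge0; exact: exprn_ge0.
  have p3 : 0 <= 2 ^+ 14 * (K ^+ 8 * N ^+ 4 * D ^+ 3 * t) by exact: mulr_ge0.
  apply: le_trans (ler_wpM2l p3 hn) _.
  by rewrite le_eqVlt; apply/orP; left; apply/eqP; ring.
have s2 : cB ^+ 3 * M ^+ 4 <= 2 ^+ 15 * K ^+ 9 * N ^+ 6 * D ^+ 3 * t.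
  have p1 : 0 <= M ^+ 4 by exact: exprn_ge0.
  apply: le_trans (ler_wpM2r p1 hG) _.
  have p2 : 0 <= K * N by exact: mulr_ge0.
  rewrite -[K * N * cG * _]mulrA; apply: le_trans (ler_wpM2l p2 s1) _.
  by rewrite le_eqVlt; apply/orP; left; apply/eqP; ring.
have N6 : 0 < N ^+ 6 by exact: exprn_gt0.
rewrite -(ler_pM2r N6).
have -> : N * N ^+ 6 = (N ^+ 2) ^+ 3 * N by ring.
have N2 : 0 <= N ^+ 2 by exact: exprn_ge0.
have w0 : 0 <= K * l * (M * cB) by apply: mulr_ge0; exact: mulr_ge0.
apply: le_trans (_ : (K * l * (M * cB)) ^+ 3 * (K * l * M) <= _).
  apply: ler_pM => //; first exact: exprn_ge0.
  by rewrite lerXn2r ?nnegrE.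
have -> : (K * l * (M * cB)) ^+ 3 * (K * l * M) = K ^+ 4 * l ^+ 4 * (cB ^+ 3 * M ^+ 4).
  by ring.
have p4 : 0 <= K ^+ 4 * l ^+ 4 by apply: mulr_ge0; exact: exprn_ge0.
apply: le_trans (ler_wpM2l p4 s2) _.
by rewrite le_eqVlt; apply/orP; left; apply/eqP; ring.
Qed.

(** * The quotients fill half of the unit interval *)

Hypothesis D1 : 1 <= D.
Hypothesis N_upper : n <= 2 ^+ L.
Hypothesis Tn : T <= n.
Hypothesis T_small :
  2 ^+ 15 * K ^+ 13 * L%:R ^+ 4 * D ^+ 3 * T `^ sigma < #|` A|%:R.

Let T0 : 0 < T. Proof. exact: lt_le_trans ltr01 T1. Qed.

Lemma K_ge1 : 1 <= K.
Proof.
rewrite -(ler_pM2r N0) mul1r; apply: le_trans doubling.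
by rewrite ler_nat card_addfsl.
Qed.

Lemma L_ge1 : 1 <= L%:R :> R.
Proof.
rewrite ler1n lt0n; apply/eqP => e; have := N_le_m.
by rewrite e mulr0 mul0r leNgt N0.
Qed.

Lemma range_sub k l : k \in B -> l \in B -> k%:~R - l%:~R <= n :> R.
Proof.
move=> /(fsubsetP BA) kA /(fsubsetP BA) lA.
by have := A2n kA; have := An lA; lra.
Qed.

(** [B] is too large to fit in an interval of length [T]. *)
Lemma separated_pair : exists k l, [/\ k \in B, l \in B & T <= k%:~R - l%:~R :> R].
Proof.
have [//|no] := pselect (exists k l, [/\ k \in B, l \in B & T <= k%:~R - l%:~R :> R]).
have : B != fset0 by rewrite -cardfs_gt0 -(ltr0n R) cardB_gt0.
case/fset0Pn => k0 k0B.
have close k l : k \in B -> l \in B -> k%:~R - l%:~R <= T :> R.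
  move=> kB lB; rewrite leNgt; apply/negP => h; apply: no.
  by exists k, l; split => //; exact: ltW.
have hB : #|` B|%:R <= D * T `^ sigma.
  apply: le_trans (nonconc k0%:~R T1); rewrite ler_nat; apply: fsubset_leq_card.
  apply/fsubsetP => k kB; rewrite !inE (fsubsetP BA) //= ler_norml.
  have := close k k0 kB k0B; have := close k0 k k0B kB.
  by move=> *; apply/andP; split; lra.
have mN : m%:R <= #|` A|%:R :> R.
  rewrite ler_nat; apply: leq_trans (popB k0B) _.
  apply: leq_trans (fsubset_leq_card (fsubsetIl _ _)) _; exact: leq_imfset_card.
have : #|` A|%:R <= K * L%:R * (D * T `^ sigma).
  rewrite -(ler_pM2r N0) -expr2; apply: le_trans B_large _.
  rewrite -!mulrA; apply: ler_wpM2l => //; apply: ler_wpM2l => //.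
  by rewrite [D * _]mulrA [leRHS]mulrC; apply: ler_pM.
rewrite leNgt => /negP[]; apply: le_lt_trans T_small.
have e2 : 1 <= 2 ^+ 15 :> R by apply: exprn_ege1; lra.
have K1 := K_ge1; have L1 := L_ge1.
have t0 : 0 <= T `^ sigma by exact: powR_ge0.
move: (T `^ sigma) t0 (L%:R : R) L1 (2 ^+ 15 : R) e2.
move=> t t0 l l1 c c1.
have p1 : K <= K ^+ 13 by rewrite -[leLHS]expr1; apply: ler_weXn2l.
have p2 : l <= l ^+ 4 by rewrite -[leLHS]expr1; apply: ler_weXn2l.
have p3 : D <= D ^+ 3 by rewrite -[leLHS]expr1; apply: ler_weXn2l.
have K0' : 0 <= K by lra.
have D0' : 0 <= D by exact: le_trans ler01 D1.
have l0' : 0 <= l by lra.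
rewrite [K * l * _]mulrA; apply: ler_wpM2r => //; apply: ler_pM => //; first exact: mulr_ge0.
apply: ler_pM => //; apply: le_trans p1 _.
by rewrite ler_peMl // exprn_ge0.
Qed.

Definition unit_quotients : set R := [set x | quotients x /\ 0 <= x <= 1].

Lemma unit_quotients0 : unit_quotients 0.
Proof.
have [k [l [kB lB kl]]] := separated_pair.
split; last by rewrite lexx ler01.
by exists k, k, k, l; split => //; split => //; rewrite subrr mul0r.
Qed.

Lemma unit_quotients1 : unit_quotients 1.
Proof.
have [k [l [kB lB kl]]] := separated_pair.
split; last by rewrite lexx ler01.
exists k, l, k, l; split => //; split => //; rewrite divff //.
by rewrite gt_eqF // (lt_le_trans T0).
Qed.

(** A quotient near the unit interval can be moved into it, because [0] and [1] are
    quotients. *)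
Lemma clamp x y s : quotients x -> 0 <= y <= 1 -> `|x - y| <= s ->
  exists2 z, unit_quotients z & `|z - y| <= s.
Proof.
move=> qx /andP[y0 y1] xy.
have [x0|x0] := ltP x 0.
  exists 0; first exact: unit_quotients0.
  apply: le_trans xy; rewrite distrC [leRHS]distrC !ger0_norm; lra.
have [x1|x1] := ltP 1 x.
  exists 1; first exact: unit_quotients1.
  apply: le_trans xy; rewrite !ger0_norm; lra.
by exists x => //; split => //; apply/andP.
Qed.

Lemma unit_quotientsP x : unit_quotients x -> exists b1 b2 b3 b4,
  [/\ b1 \in B, b2 \in B, b3 \in B & b4 \in B] /\
  [/\ T <= b3%:~R - b4%:~R :> R, x = (b1%:~R - b2%:~R) / (b3%:~R - b4%:~R),
     0 <= b1%:~R - b2%:~R :> R & b1%:~R - b2%:~R <= b3%:~R - b4%:~R :> R].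
Proof.
move=> [[b1 [b2 [b3 [b4 [bB [f e]]]]]] /andP[x0 x1]].
exists b1, b2, b3, b4; split => //.
have f0 : 0 < b3%:~R - b4%:~R :> R by exact: lt_le_trans T0 f.
split => //.
  by move: x0; rewrite e pmulr_lge0 ?invr_gt0.
by move: x1; rewrite e ler_pdivrMr ?mul1r.
Qed.

(** Both inverse branches of the Farey map send [e / f] to a point of the form
    considered in [quotient_near]: here [f / (e + f)], and [e / (f + e)] below. *)
Lemma unit_quotients_inv x : unit_quotients x ->
  exists2 y, unit_quotients y & `|y - (1 + x)^-1| <= 4 * n / T ^+ 2.
Proof.
move=> qx; have /andP[x0 x1] := qx.2.
have [b1 [b2 [b3 [b4 [[B1 B2 B3 B4] [f xe e0 ef]]]]]] := unit_quotientsP qx.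
have f0 : 0 < b3%:~R - b4%:~R :> R by exact: lt_le_trans T0 f.
have eF : 0 <= (b1%:~R - b2%:~R : R) <= b3%:~R - b4%:~R by rewrite e0.
have fF : 0 <= (b3%:~R - b4%:~R : R) <= b3%:~R - b4%:~R by rewrite (ltW f0) /=.
have FE : b3%:~R - b4%:~R <= (b1%:~R - b2%:~R) + (b3%:~R - b4%:~R) :> R.
  by rewrite lerDr.
have [y qy yx] := quotient_near B1 B2 B3 B4 eF fF FE f (range_sub B3 B4) T_small.
apply: (clamp qy).
  by rewrite invr_ge0 invf_le1; [apply/andP; split; lra | lra].
move: yx; rewrite (_ : (1 + x)^-1 = (b3%:~R - b4%:~R) /
  ((b1%:~R - b2%:~R) + (b3%:~R - b4%:~R))) //.
rewrite xe; move: f0 e0; move: (b3%:~R - b4%:~R : R) (b1%:~R - b2%:~R : R) => u v u0 v0.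
by field; apply/andP; split; apply/lt0r_neq0; lra.
Qed.

Lemma unit_quotients_shift x : unit_quotients x ->
  exists2 y, unit_quotients y & `|y - x / (1 + x)| <= 4 * n / T ^+ 2.
Proof.
move=> qx; have /andP[x0 x1] := qx.2.
have [b1 [b2 [b3 [b4 [[B1 B2 B3 B4] [f xe e0 ef]]]]]] := unit_quotientsP qx.
have f0 : 0 < b3%:~R - b4%:~R :> R by exact: lt_le_trans T0 f.
have eF : 0 <= (b1%:~R - b2%:~R : R) <= b3%:~R - b4%:~R by rewrite e0.
have fF : 0 <= (b3%:~R - b4%:~R : R) <= b3%:~R - b4%:~R by rewrite (ltW f0) /=.
have FE : b3%:~R - b4%:~R <= (b3%:~R - b4%:~R) + (b1%:~R - b2%:~R) :> R.
  by rewrite lerDl.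
have [y qy yx] := quotient_near B3 B4 B1 B2 fF eF FE f (range_sub B3 B4) T_small.
apply: (clamp qy).
  by rewrite divr_ge0 ?ler_pdivrMr ?mul1r /=; lra.
move: yx; rewrite (_ : x / (1 + x) = (b1%:~R - b2%:~R) /
  ((b3%:~R - b4%:~R) + (b1%:~R - b2%:~R))) //.
rewrite xe; move: f0 e0; move: (b3%:~R - b4%:~R : R) (b1%:~R - b2%:~R : R) => u v u0 v0.
by field; apply/andP; split; apply/lt0r_neq0; lra.
Qed.

Let eps : R := 2 * ((L * (4 * L) + 1)%:R * (4 * n / T ^+ 2)).

Lemma quotient_measure : exists M : seq (R * R),
  [/\ forall x : R * R, x \in M -> unit_quotients x.1 /\ 0 <= x.2,
    2^-1 <= \sum_(x <- M) x.2 &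
    forall p q, p <= q -> \sum_(x <- M | p <= x.1 <= q) x.2 <= q - p + eps].
Proof.
have L1 : (0 < L)%N by rewrite -(ltr0n R) (lt_le_trans ltr01 L_ge1).
apply: (farey_measure unit_quotients0) => //.
- by move=> x [].
- exact: unit_quotients_shift.
- exact: unit_quotients_inv.
- by rewrite muln_gt0.
have e0 : 0 < 2 ^+ L :> R by exact: exprn_gt0.
rewrite ler_pdivlMr ?exprn_gt0 // mulrC ler_pdivrMr //.
apply: le_trans (_ : n ^+ 2 <= _).
  by rewrite lerXn2r ?nnegrE // ltW.
rewrite expr2; apply: ler_pM; rewrite ?(ltW n0) //.
by rewrite ler_peMl ?(ltW n0) //; lra.
Qed.


(** The upper bound for the image of a form and the threshold for collisions both
    depend on the denominator, so only quotients with comparable denominators are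
    averaged together. *)
Definition quotient_class (i : nat) (x : R) := exists b1 b2 b3 b4 : int,
  [/\ b1 \in B, b2 \in B, b3 \in B & b4 \in B] /\
  [/\ T <= b3%:~R - b4%:~R :> R, x = (b1%:~R - b2%:~R) / (b3%:~R - b4%:~R),
     0 <= b1%:~R - b2%:~R :> R, b1%:~R - b2%:~R <= b3%:~R - b4%:~R :> R &
     2 ^+ i <= (b3%:~R - b4%:~R : R) <= 2 * 2 ^+ i].

Lemma quotient_class_exists x : unit_quotients x ->
  exists2 i, (i < L.+1)%N & quotient_class i x.
Proof.
case/unit_quotientsP => b1 [b2 [b3 [b4 [bB [f xe e0 ef]]]]].
have [B1 B2 B3 B4] := bB.
have fn := range_sub B3 B4.
have fL : b3%:~R - b4%:~R <= 2 ^+ L * 1 :> R by rewrite mulr1 (le_trans fn).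
have [k [kL fk hk]] := dyadic_index fL; rewrite mulr1 in fk hk.
exists k.-1; first by rewrite ltnS (leq_trans (leq_pred k)).
exists b1, b2, b3, b4; split => //; split => //.
have T1' := T1; case: hk => [k0|].
  by rewrite k0 expr0 in fk *; apply/andP; split; lra.
case: k fk kL => [|k] fk _ h; first by rewrite !expr0 in fk h *; apply/andP; split; lra.
by rewrite exprS in fk h; apply/andP; split => /=; lra.
Qed.

(** The image of the form of a quotient is small by [card_form_image], so the form
    has many collisions. *)
Lemma energy_lower i x (r := 2 ^+ i : R) : quotient_class i x ->
  #|` A|%:R ^+ 4 <= 2 ^+ 13 * K ^+ 12 * L%:R ^+ 4 * D * (r `^ sigma *
    \sum_(p <- A `*` A) \sum_(q <- A `*` A) (collide n r x p q)%:R).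
Proof.
move=> [b1 [b2 [b3 [b4 [[B1 B2 B3 B4] [f xe e0 ef /andP[rf fr]]]]]]].
set phi := b3%:~R - b4%:~R : R in f xe ef rf fr.
set eta := b1%:~R - b2%:~R : R in xe e0 ef.
have T1' := T1; have r0 : 0 < r by exact: exprn_gt0.
have f0 : 0 < phi by lra.
have f1 : 1 <= phi by lra.
have eF : 0 <= eta <= phi by rewrite e0.
have fF : 0 <= phi <= phi by rewrite lexx (ltW f0).
have im := card_form_image B1 B2 B3 B4 (fsubset_refl _) f1 eF fF.
set g := linear_form b1 b2 b3 b4 in im.
set E := \sum_(p <- _) _.
have cc : #|` A|%:R ^+ 4 <= #|` [fset g p | p in A `*` A]|%:R * E.
  have := card_collisions g (A `*` A); rewrite card_fsetM mulnn -expnM.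
  rewrite -(ler_nat R) natrX => /le_trans; apply; rewrite natrM ler_wpM2l //.
  rewrite /E natr_sum; apply: ler_sum => p _; rewrite natr_sum; apply: ler_sum => q _.
  rewrite ler_nat leq_b1_imp //.
  move=> /eqP gpq.
  have := linear_formP b1 b2 b3 b4 p; have := linear_formP b1 b2 b3 b4 q.
  rewrite -/g gpq -/eta -/phi => h1 h2.
  have : `|(eta * p.1%:~R + phi * p.2%:~R) / n - (eta * q.1%:~R + phi * q.2%:~R) / n| < 4.
    move: h1 h2; rewrite !ltr_norml => /andP[? ?] /andP[? ?].
    by apply/andP; split; lra.
  rewrite -mulrBl normrM [X in _ * X]ger0_norm; last by rewrite invr_ge0 ltW.
  rewrite ltr_pdivrMr // => h; rewrite /collide.
  apply: le_trans (_ : 4 * n / phi <= _); last first.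
    by apply: ler_wpM2l; [rewrite mulr_ge0 // ltW | rewrite lef_pV2 ?posrE].
  rewrite ler_pdivlMr // -[X in _ * X](gtr0_norm f0) -normrM; apply: le_trans (ltW h).
  rewrite le_eqVlt; apply/orP; left; apply/eqP; congr `|_|.
  by rewrite xe; field; exact/lt0r_neq0.
have E0 : 0 <= E by apply: sumr_ge0 => p _; apply: sumr_ge0.
have hm := N_le_m.
have M0 : 0 <= m%:R :> R by [].
have M0' : 0 < m%:R :> R.
  rewrite lt0r M0 andbT; apply/eqP => e; move: hm; rewrite e mulr0 leNgt.
  by rewrite N0.
have fs : phi `^ sigma <= 2 * r `^ sigma.
  have c2 : 1 <= 2 :> R by rewrite ler1n.
  apply: le_trans (powR_scale sigma01 c2 (ltW r0)).
  have s0 : 0 <= sigma by case/andP: sigma01 => /ltW.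
  by apply: (ge0_ler_powR s0); rewrite ?nnegrE ?mulr_ge0 // ltW.
move: hm cc im fs (powR_ge0 phi sigma) (powR_ge0 r sigma) N0 (ler0n R L) M0 M0' E0 D0 K0.
move: (phi `^ sigma) (r `^ sigma) (#|` A|%:R : R) (L%:R : R) (m%:R : R) E
  (#|` [fset g p | p in A `*` A]|%:R : R) D K.
move=> t u N l M E I d k hm cc im tu t0 u0 N0' l0 M0 M0' E0 d0 k0.
have N4 : 0 < N ^+ 4 by exact: exprn_gt0.
have M4 : 0 < M ^+ 4 by exact: exprn_gt0.
have c12 : 0 <= 2 ^+ 12 * k ^+ 8 * N ^+ 4 * d.
  apply: mulr_ge0 => //; apply: mulr_ge0; last exact: exprn_ge0 (ltW N0').
  by apply: mulr_ge0; exact: exprn_ge0.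
have s1 : M ^+ 4 <= 2 ^+ 13 * k ^+ 8 * d * (u * E).
  rewrite -(ler_pM2l N4).
  apply: le_trans (ler_wpM2r (ltW M4) cc) _.
  rewrite mulrAC; apply: le_trans (ler_wpM2r E0 im) _.
  apply: le_trans (ler_wpM2r E0 (ler_wpM2l c12 tu)) _.
  by rewrite le_eqVlt; apply/orP; left; apply/eqP; ring.
apply: le_trans (_ : (k * l * M) ^+ 4 <= _).
  by rewrite lerXn2r ?nnegrE ?mulr_ge0 // ltW.
have -> : (k * l * M) ^+ 4 = k ^+ 4 * l ^+ 4 * M ^+ 4 by ring.
have p4 : 0 <= k ^+ 4 * l ^+ 4 by apply: mulr_ge0; exact: exprn_ge0.
apply: le_trans (ler_wpM2l p4 s1) _.
by rewrite le_eqVlt; apply/orP; left; apply/eqP; ring.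
Qed.

(** The upper and lower bounds for the number of collisions, averaged over the
    quotients of one class. *)
Lemma dense_bound :
  1 <= 2 ^+ 34 * K ^+ 12 * L%:R ^+ 8 * D ^+ 3 *
    ((T `^ sigma)^-1 + n `^ sigma * (n / T ^+ 2)).
Proof.
have [M [Mq Mhalf Mleb]] := quotient_measure.
have L1 := L_ge1.
pose cl i (x : R * R) := `[< quotient_class i x.1 >].
pose S i := \sum_(x <- M | cl i x) x.2.
have cover : \sum_(x <- M) x.2 <= \sum_(i < L.+1) S i.
  rewrite /S; under [leRHS]eq_bigr => i _ do rewrite big_mkcond.
  rewrite exchange_big /= big_seq [leRHS]big_seq; apply: ler_sum => x xM.
  have [qx x20] := Mq x xM.
  have [i iL ci] := quotient_class_exists qx.
  rewrite (bigD1 (Ordinal iL)) //= /cl asboolT // lerDl.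
  by apply: sumr_ge0 => j _; case: ifP.
have sI : index_enum 'I_L.+1 != [::].
  by apply/eqP => e; have := mem_index_enum (@ord0 L); rewrite e.
have [i _ hi] := exists_ge_averager (fun i : 'I_L.+1 => S i) sI.
have sizeI : size (index_enum 'I_L.+1) = L.+1 by rewrite -[index_enum _]enumT -cardT card_ord.
rewrite sizeI in hi.
have half : 2^-1 <= L.+1%:R * S i by apply: le_trans Mhalf (le_trans cover hi).
have [x xM cx] : exists2 x, x \in M & cl i x.
  apply/hasP; apply: contraTT half => /hasPn no.
  rewrite /S big1_seq ?mulr0 -?ltNge //.
  by move=> x /andP[ci xM]; have := no x xM; rewrite ci.
pose r : R := 2 ^+ i.
have r1 : 1 <= r by rewrite exprn_ege1 // ler1n.
have [rn Tr] : r <= n /\ T <= 2 * r.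
  move/asboolP: cx => [b1 [b2 [b3 [b4 [[B1 B2 B3 B4] [f _ _ _ /andP[rf fr]]]]]]].
  split; last exact: le_trans f fr.
  by apply: (le_trans rf); exact: range_sub.
have M01 y : y \in M -> 0 <= y.1 <= 1 /\ 0 <= y.2.
  by move=> /Mq[[_ ?] ?].
have up := energy_upper sigma01 A_range D0 nonconc M01 Mleb r1 rn N_upper (cl i).
have lo : #|` A|%:R ^+ 4 * S i <= 2 ^+ 13 * K ^+ 12 * L%:R ^+ 4 * D *
   (r `^ sigma * \sum_(x <- M | cl i x) x.2 *
     \sum_(p <- A `*` A) \sum_(q <- A `*` A) (collide n r x.1 p q)%:R).
  rewrite /S !mulr_sumr big_seq_cond [leRHS]big_seq_cond.
  apply: ler_sum => y /andP[yM /asboolP cy]; have [_ y2] := Mq y yM.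
  rewrite mulrC; apply: le_trans (ler_wpM2l y2 (energy_lower cy)) _.
  by rewrite le_eqVlt; apply/orP; left; apply/eqP; ring.
have K1 := K_ge1; have T0' := T0; have n0' := n0; have Tn' := Tn; have N0' := N0.
have D1' := D1; have NL := N_lower.
set a := n `^ sigma in NL up *; set u := r `^ sigma in up lo.
have r0 : 0 < r by lra.
have u0 : 0 < u by exact: powR_gt0.
have a0 : 0 < a by exact: powR_gt0.
have s0 : 0 <= sigma by case/andP: sigma01 => /ltW.
have ua : u <= a by apply: (ge0_ler_powR s0); rewrite ?nnegrE // ltW.
have t0 : 0 < T `^ sigma by exact: powR_gt0.
have tu : T `^ sigma <= 2 * u.
  have c2 : 1 <= 2 :> R by rewrite ler1n.
  apply: le_trans (powR_scale sigma01 c2 (ltW r0)).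
  by apply: (ge0_ler_powR s0); rewrite ?nnegrE ?mulr_ge0 // ltW.
set w := n / T ^+ 2.
have w0 : 0 < w by rewrite divr_gt0 // exprn_gt0.
have Tw : T^-1 <= w.
  rewrite /w ler_pdivlMr ?exprn_gt0 // expr2 mulrA mulVf ?mul1r //.
  exact: lt0r_neq0.
have epsE : eps = 8 * (4 * L%:R ^+ 2 + 1) * w.
  by rewrite /eps /w natrD !natrM; ring.
have V : u^-1 + u / r + a * eps <= 2 ^+ 6 * L%:R ^+ 2 * ((T `^ sigma)^-1 + a * w).
  have h1 : u^-1 <= 2 * (T `^ sigma)^-1.
    by rewrite -(invrK 2) -invfM lef_pV2 ?posrE ?mulr_gt0 ?invr_gt0 // mulrC ler_pdivrMr // mulrC.
  have h2 : u / r <= 2 * (a * w).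
    apply: le_trans (_ : a * (2 * T^-1) <= _).
      apply: ler_pM => //; rewrite ?(ltW u0) ?invr_ge0 ?(ltW r0) //.
      by rewrite -(invrK 2) -invfM lef_pV2 ?posrE ?mulr_gt0 ?invr_gt0 // mulrC ler_pdivrMr // mulrC.
    by rewrite mulrCA ler_pM2l // ler_pM2l.
  have aw0 : 0 <= a * w by rewrite mulr_ge0 // ltW.
  have l2 : 1 <= L%:R ^+ 2 :> R by rewrite exprn_ege1.
  have p0 : 0 <= (T `^ sigma)^-1 by rewrite invr_ge0 ltW.
  rewrite epsE (_ : 2 ^+ 6 = 64 :> R); last by rewrite -natrX.
  move: h1 h2; move: aw0 l2 p0.
  have -> : a * (8 * (4 * L%:R ^+ 2 + 1) * w) = 8 * (4 * L%:R ^+ 2 + 1) * (a * w) by ring.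
  move: (a * w) (L%:R ^+ 2 : R) ((T `^ sigma)^-1) (u^-1) (u / r) => y l p q1 q2 *.
  by nra.
have V0 : 0 <= u^-1 + u / r + a * eps.
  rewrite !addr_ge0 ?invr_ge0 ?divr_ge0 ?(ltW u0) ?(ltW r0) // epsE mulr_ge0 ?(ltW a0) //.
  by rewrite mulr_ge0 ?(ltW w0) // mulr_ge0 // addr_ge0 ?mulr_ge0 ?exprn_ge0.
have S0 : 0 <= S i.
  by rewrite /S big_seq_cond; apply: sumr_ge0 => y /andP[/Mq[]].
have L2 : L.+1%:R <= 2 * L%:R :> R by rewrite -natr1; lra.
move: up lo half V V0 S0 L2 NL.
set W := \sum_(x <- M | _) _; set V := u^-1 + u / r + a * eps.
set Y := (T `^ sigma)^-1 + a * w; set N : R := #|` A|%:R; set l : R := L%:R.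
move=> up lo half VY V0 S0 ll NL.
have Np : 0 <= N := ltW N0'.
have Kp : 0 <= K by lra.
have Dp : 0 <= D by lra.
have lp : 0 <= l by lra.
have N4 : 0 < N ^+ 4 by exact: exprn_gt0.
have l'0 : 0 <= L.+1%:R :> R by [].
have kld (c : R) i1 i2 i3 : 0 <= c -> 0 <= c * K ^+ i1 * l ^+ i2 * D ^+ i3.
  move=> c0; apply: mulr_ge0; last exact: exprn_ge0.
  by apply: mulr_ge0; [apply: mulr_ge0 => // |]; exact: exprn_ge0.
have c0 i1 : 0 <= 2 ^+ i1 :> R by exact: exprn_ge0.
have s1 : N ^+ 4 * S i <= 2 ^+ 13 * K ^+ 12 * l ^+ 4 * D ^+ 1 *
    (L.+1%:R * (2 ^+ 9 * D ^+ 2 * N ^+ 2 * a ^+ 2 * V)).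
  by apply: le_trans lo _; rewrite expr1; apply: ler_wpM2l up; rewrite -(expr1 D); exact: kld.
have s2 : N ^+ 4 <= 2 * L.+1%:R * (N ^+ 4 * S i).
  have -> : 2 * L.+1%:R * (N ^+ 4 * S i) = N ^+ 4 * (2 * (L.+1%:R * S i)) by ring.
  by rewrite ler_peMr ?(ltW N4) //; lra.
have s3 : N ^+ 4 <= (2 ^+ 23 * K ^+ 12 * l ^+ 4 * D ^+ 3) *
     (L.+1%:R ^+ 2 * (N ^+ 2 * (a ^+ 2 * V))).
  apply: le_trans s2 _; apply: le_trans (ler_wpM2l _ s1) _; first exact: mulr_ge0.
  by rewrite le_eqVlt; apply/orP; left; apply/eqP; ring.
have ll2 : L.+1%:R ^+ 2 <= 4 * l ^+ 2 :> R.
  rewrite (_ : 4 * l ^+ 2 = (2 * l) ^+ 2); last by ring.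
  by rewrite lerXn2r ?nnegrE // mulr_ge0.
have aN : a ^+ 2 <= 4 * N ^+ 2.
  rewrite (_ : 4 * N ^+ 2 = (2 * N) ^+ 2); last by ring.
  by rewrite lerXn2r ?nnegrE ?mulr_ge0 // ltW.
have N20 : 0 <= N ^+ 2 by exact: exprn_ge0.
have a20 : 0 <= a ^+ 2 by apply: exprn_ge0; exact: ltW.
rewrite -(ler_pM2l N4) mulr1; apply: le_trans s3 _.
apply: le_trans (_ : (2 ^+ 23 * K ^+ 12 * l ^+ 4 * D ^+ 3) *
     ((4 * l ^+ 2) * (N ^+ 2 * ((4 * N ^+ 2) * (2 ^+ 6 * l ^+ 2 * Y)))) <= _).
  apply: ler_wpM2l; first exact: kld.
  apply: ler_pM; [exact: exprn_ge0 | by rewrite mulr_ge0 // mulr_ge0 | exact: ll2 |].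
  by apply: ler_wpM2l => //; exact: ler_pM.
rewrite -subr_ge0.
set c := (X in 0 <= X).
have -> : c = (2 ^+ 33 * K ^+ 12 * l ^+ 8 * D ^+ 3) * (N ^+ 4 * Y).
  by rewrite /c; ring.
apply: mulr_ge0; first exact: kld.
apply: mulr_ge0; first exact: ltW.
by apply: addr_ge0; [rewrite invr_ge0; exact: ltW | apply: mulr_ge0; exact: ltW].
Qed.


End QuotientSet.
End LinearForms.
End DiscreteSumProduct.

(** * The discrete sum-product inequality *)

Section DiscreteTheorem.
Variable R : realType.

(** The scale [T] is taken as large as [quotient_near] allows.  Either [T] cannot
    reach [1], and then the set is already small compared with the other parameters,
    or [dense_bound] applies and one of its two terms is at least half of the
    total. *)
Theorem discrete_sum_product (n sigma D K : R) (A : {fset int}) (L : nat) :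
  1 <= n -> 0 < sigma < 1 -> A != fset0 ->
  (forall k, k \in A -> n <= k%:~R <= 2 * n) ->
  1 <= D ->
  (forall c l : R, 1 <= l ->
    #|` [fset k in A | `|k%:~R - c| <= l]|%fset%:R <= D * l `^ sigma) ->
  0 <= K ->
  #|` addfs A A|%:R <= K * #|` A|%:R ->
  #|` [fset dil n p.1 p.2 | p in (A `*` A)%fset]|%fset%:R <= K * #|` A|%:R ->
  (#|` A| < 2 ^ L)%N -> n <= 2 ^+ L -> n `^ sigma <= 2 * #|` A|%:R ->
  n `^ (sigma * (1 - sigma)) <=
    2 ^+ 69 * K `^ (26 + 12 * sigma) * L%:R ^+ 16 * D ^+ 9.
Proof.
move=> n1 sigma01 A0 A_range D1 nonconc K0 doubling product NL nL N_lower.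
have N0 : 0 < #|` A|%:R :> R by rewrite ltr0n cardfs_gt0.
have n0 : 0 < n by exact: lt_le_trans ltr01 n1.
have An k : k \in A -> n <= k%:~R by case/A_range/andP.
have A2n k : k \in A -> k%:~R <= 2 * n by case/A_range/andP.
have [b [B [m [bA BA m0 popB cB]]]] := popular_dilates n1 An A0 NL.
have B_large : #|` A|%:R ^+ 2 <= K * L%:R * (m%:R * #|` B|%:R) :> R.
  have := cB; rewrite -(ler_nat R) natrX !natrM => h.
  rewrite -(ler_pM2r N0) -exprSr; apply: le_trans h _.
  rewrite [leRHS]mulrC -[K * _ * _]mulrA [leRHS]mulrA [_ * K]mulrC.
  by apply: ler_wpM2r product; rewrite !mulr_ge0.
have D0 : 0 <= D by exact: le_trans ler01 D1.
have K1 : 1 <= K.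
  by rewrite -(ler_pM2r N0) mul1r; apply: le_trans doubling; rewrite ler_nat card_addfsl.
have L1 : 1 <= L%:R :> R.
  rewrite ler1n lt0n; apply: contraTneq NL => ->.
  by rewrite expn0 ltnS leqn0 cardfs_eq0.
have /andP[s0 s1] := sigma01.
have s0' := ltW s0.
have N_n : #|` A|%:R <= D * n `^ sigma.
  apply: (le_trans _ (nonconc n n n1)); rewrite ler_nat; apply: fsubset_leq_card.
  apply/fsubsetP => k kA; rewrite !inE kA /= ler_norml.
  by have := An k kA; have := A2n k kA => *; apply/andP; split; lra.
set G : R := 2 ^+ 15 * K ^+ 13 * L%:R ^+ 4 * D ^+ 3.
have e1 i : 1 <= 2 ^+ i :> R by rewrite exprn_ege1 // ler1n.
have e0 i : 0 <= 2 ^+ i :> R by exact: exprn_ge0.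
have L0 : 0 <= L%:R :> R by [].
have prod1 i k l d : 1 <= 2 ^+ i * K ^+ k * L%:R ^+ l * D ^+ d.
  apply: mulr_ege1; last exact: exprn_ege1.
  by apply: mulr_ege1; [apply: mulr_ege1 => // |]; exact: exprn_ege1.
have G1 : 1 <= G by exact: prod1.
have G0 : 0 < G by lra.
set tau := #|` A|%:R / (2 * G).
have tau0 : 0 < tau by rewrite divr_gt0 // mulr_gt0.
have Ntau : #|` A|%:R = 2 * G * tau by rewrite /tau mulrC divfK // gt_eqF // mulr_gt0.
have n_tau : n `^ sigma <= 4 * G * tau by rewrite Ntau in N_lower; lra.
have nn : n `^ (sigma * (1 - sigma)) <= n `^ sigma.
  by apply: ler_powR => //; rewrite ler_piMr // lerBlDr lerDl.
have Kpow (i : nat) : (i <= 26)%N -> K ^+ i <= K `^ (26 + 12 * sigma).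
  move=> i26; rewrite -powR_mulrn //; apply: ler_powR => //.
  have : i%:R <= 26%:R :> R by rewrite ler_nat.
  by move=> h; apply: (le_trans h); rewrite lerDl mulr_ge0.
have weak (i k l d : nat) : (i <= 69)%N -> (k <= 26)%N -> (l <= 16)%N -> (d <= 9)%N ->
    2 ^+ i * K ^+ k * L%:R ^+ l * D ^+ d <=
    2 ^+ 69 * K `^ (26 + 12 * sigma) * L%:R ^+ 16 * D ^+ 9.
  move=> hi hk hl hd.
  have p1 : 2 ^+ i <= 2 ^+ 69 :> R by apply: ler_weXn2l => //; rewrite ler1n.
  have p3 : L%:R ^+ l <= L%:R ^+ 16 :> R by apply: ler_weXn2l.
  have p4 : D ^+ d <= D ^+ 9 by apply: ler_weXn2l.
  have q1 := exprn_ge0 k K0; have q2 := exprn_ge0 l L0; have q3 := exprn_ge0 d D0.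
  apply: ler_pM => //; first by apply: mulr_ge0 => //; exact: mulr_ge0.
  apply: ler_pM => //; first exact: mulr_ge0.
  by apply: ler_pM => //; exact: Kpow.
have [tau1|tau1] := ltP tau 1.
  apply: le_trans nn _; apply: le_trans (_ : 4 * G <= _).
    by apply: le_trans n_tau _; rewrite ler_piMr ?(ltW tau1) // mulr_ge0 // ltW.
  have -> : 4 * G = 2 ^+ 17 * K ^+ 13 * L%:R ^+ 4 * D ^+ 3 by rewrite /G; ring.
  exact: weak.
set T := tau `^ sigma^-1.
have Ts : T `^ sigma = tau by rewrite /T -powRrM mulVf ?gt_eqF // powRr1 // ltW.
have sV0 : 0 <= sigma^-1 by rewrite invr_ge0.
have T1 : 1 <= T.
  apply: le_trans (_ : 1 `^ sigma^-1 <= _); first by rewrite powR1.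
  by apply: (ge0_ler_powR sV0); rewrite ?nnegrE // ltW.
have DG : D <= 2 * G.
  have : D <= G.
    rewrite /G; apply: le_trans (_ : 1 * D ^+ 1 <= _); first by rewrite mul1r expr1.
    apply: ler_pM => //; last exact: ler_weXn2l.
    by have := prod1 15%N 13%N 4%N 0%N; rewrite expr0 mulr1.
  by lra.
have tau_n : tau <= n `^ sigma.
  have G20 : 0 < 2 * G by exact: mulr_gt0.
  rewrite /tau ler_pdivrMr //; apply: (le_trans N_n).
  by rewrite mulrC ler_wpM2l ?powR_ge0.
have Tn : T <= n.
  apply: le_trans (_ : (n `^ sigma) `^ sigma^-1 <= _); last first.
    by rewrite -powRrM mulfV ?gt_eqF // powRr1 // ltW.
  by apply: (ge0_ler_powR sV0); rewrite ?nnegrE ?powR_ge0 // ltW.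
have T_small : G * T `^ sigma < #|` A|%:R.
  by rewrite Ts Ntau ltr_pM2r // ltr_pMl // ltr1n.
have T0 : 0 < T by lra.
have dense : 1 <= 2 ^+ 34 * K ^+ 12 * L%:R ^+ 8 * D ^+ 3 *
    ((T `^ sigma)^-1 + n `^ sigma * (n / T ^+ 2)).
  exact: (dense_bound n1 A0 A_range bA BA popB sigma01).
set H := 2 ^+ 34 * _ * _ * _ in dense.
have H1 : 1 <= H by exact: prod1.
have H0 : 0 < H by lra.
have [c1|c2] := lerP 1 (2 * H * tau^-1).
  have tH : tau <= 2 * H by move: c1; rewrite ler_pdivlMr // mul1r.
  apply: le_trans nn _; apply: le_trans n_tau _.
  apply: le_trans (_ : 4 * G * (2 * H) <= _).
    by rewrite ler_wpM2l // mulr_ge0 // ltW.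
  have -> : 4 * G * (2 * H) = 2 ^+ 52 * K ^+ 25 * L%:R ^+ 12 * D ^+ 6.
    by rewrite /G /H; ring.
  exact: weak.
have T2 : T ^+ 2 <= 2 * H * (n `^ sigma * n).
  have T20 : 0 < T ^+ 2 by exact: exprn_gt0.
  have : 1 <= 2 * H * (n `^ sigma * n) / T ^+ 2.
    have -> : 2 * H * (n `^ sigma * n) / T ^+ 2 = 2 * (H * (n `^ sigma * (n / T ^+ 2))).
      by ring.
    by move: dense c2; rewrite Ts mulrDr -(mulrA 2); lra.
  by rewrite ler_pdivlMr // mul1r.
have a0 : 0 < n `^ sigma by exact: powR_gt0.
have tau2 : tau ^+ 2 <= (2 * H) `^ sigma * (n `^ (sigma * sigma) * n `^ sigma).
  rewrite -Ts expr2 -powRM ?(ltW T0) // -expr2.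
  rewrite [n `^ (sigma * sigma)]powRrM -powRM ?powR_ge0 ?(ltW n0) //.
  rewrite -powRM ?mulr_ge0 ?powR_ge0 ?(ltW n0) ?(ltW H0) //.
  by apply: (ge0_ler_powR s0'); rewrite ?nnegrE ?exprn_ge0 ?(ltW T0) //;
    rewrite !mulr_ge0 ?powR_ge0 ?(ltW n0) ?(ltW H0).
have Hs : (2 * H) `^ sigma <= 2 ^+ 35 * K `^ (12 * sigma) * L%:R ^+ 8 * D ^+ 3.
  have -> : 2 * H = (2 ^+ 35 * K ^+ 0 * L%:R ^+ 8 * D ^+ 3) * K ^+ 12 by rewrite /H; ring.
  apply: le_trans (powR_scale sigma01 (prod1 _ _ _ _) (exprn_ge0 12 K0)) _.
  rewrite -[K ^+ 12]powR_mulrn // -powRrM.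
  by rewrite le_eqVlt; apply/orP; left; apply/eqP; ring.
have n2 : n `^ sigma ^+ 2 <= 16 * G ^+ 2 * tau ^+ 2.
  rewrite (_ : 16 * G ^+ 2 * tau ^+ 2 = (4 * G * tau) ^+ 2); last by ring.
  rewrite lerXn2r ?nnegrE // ?(ltW a0) //.
  by apply: mulr_ge0; [apply: mulr_ge0 => // |]; exact: ltW.
have split_n : n `^ sigma = n `^ (sigma * (1 - sigma)) * n `^ (sigma * sigma).
  rewrite -powRD; first by congr (_ `^ _); ring.
  by rewrite (gt_eqF n0) implybT.
have b0 : 0 < n `^ (sigma * sigma) by exact: powR_gt0.
rewrite -(ler_pM2r (mulr_gt0 b0 a0)).
have -> : n `^ (sigma * (1 - sigma)) * (n `^ (sigma * sigma) * n `^ sigma) = n `^ sigma ^+ 2.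
  by rewrite mulrA -split_n expr2.
apply: le_trans n2 _.
have g0 : 0 <= 16 * G ^+ 2 by apply: mulr_ge0 => //; exact: exprn_ge0 (ltW G0).
apply: le_trans (ler_wpM2l g0 tau2) _.
rewrite [leLHS]mulrA; apply: ler_wpM2r.
  by apply: mulr_ge0; exact: ltW.
apply: le_trans (ler_wpM2l g0 Hs) _.
have -> : K `^ (26 + 12 * sigma) = K ^+ 26 * K `^ (12 * sigma).
  by rewrite powRD ?powR_mulrn // (gt_eqF (lt_le_trans ltr01 K1)) implybT.
by rewrite le_eqVlt; apply/orP; left; apply/eqP; rewrite /G; ring.
Qed.


End DiscreteTheorem.

(** * From measures to grid points *)

Section Transfer.
Variable R : realType.
Implicit Types (S : set R) (P : {fset int}) (delta : R).

Lemma le_lebesgue_measure (S S' : set R) : S `<=` S' ->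
  (lebesgue_measure S <= lebesgue_measure S')%E.
Proof.
move=> sub; exact: (@le_mu_ext _ _ R (wlength idfun) S S' sub).
Qed.

(** Open intervals, so that neighbours sharing an end point are disjoint. *)
Lemma packing_separated S P delta (x : int -> R) : 0 < delta ->
  (forall p, p \in P -> `[x p, x p + delta] `<=` S /\
     (p%:~R - 1) * delta <= x p /\ x p + delta <= (p%:~R + 2) * delta) ->
  (forall p q, p \in P -> q \in P -> p != q -> (p + 3 <= q)%R \/ (q + 3 <= p)%R) ->
  ((#|` P|%fset%:R * delta)%:E <= lebesgue_measure S)%E.
Proof.
move=> d0 xP sep.
pose J p : set R := `]x p, x p + delta[%classic.
have mJ p : lebesgue_measure (J p) = delta%:E.
  by rewrite lebesgue_measure_itv /= lte_fin ltrDl d0 -EFinB addrAC subrr add0r.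
have measJ p : measurable (J p) by exact: measurable_itv.
pose U := \big[setU/set0]_(p <- enum_fset P) J p.
apply: (@le_trans _ _ (lebesgue_measure U)); last first.
  apply: le_lebesgue_measure; rewrite /U -bigcup_seq => z [p /= pP].
  rewrite /J /= in_itv /= => /andP[z1 z2]; have [sub _] := xP p pP.
  by apply: sub; rewrite /= in_itv /= !ltW.
have order p q z : p \in P -> q \in P -> (p + 3 <= q)%R -> J p z -> ~ J q z.
  move=> pP qP pq; rewrite /J /= !in_itv /= => /andP[_ zp] /andP[qz _].
  have [_ [_ h1]] := xP p pP; have [_ [h2 _]] := xP q qP.
  have : (p%:~R + 2) * delta <= (q%:~R - 1) * delta.
    rewrite ler_wpM2r ?(ltW d0) //.
    move: pq; rewrite -(ler_int R) intrD (_ : 3%:~R = 3 :> R) // => pq; lra.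
  by lra.
have mU : lebesgue_measure U = (#|` P|%fset%:R * delta)%:E.
  rewrite /U; have := fset_uniq P; have : {subset enum_fset P <= P} by [].
  elim: (enum_fset P) => [|p s IH] sP /=.
    by rewrite big_nil measure0 mul0r.
  move=> /andP[ps us]; rewrite big_cons measureU //.
  - rewrite -natr1 mulrDl mul1r addrC EFinD; congr (_ + _)%E; last exact: mJ.
    by apply: IH => // q qs; apply: sP; rewrite inE qs orbT.
  - exact: measJ.
  - by apply: bigsetU_measurable => *; exact: measJ.
  - apply/seteqP; split => // z [zp]; rewrite -bigcup_seq => -[q /= qs zq].
    have pP : p \in P by apply: sP; rewrite inE eqxx.
    have qP : q \in P by apply: sP; rewrite inE qs orbT.
    have pq : p != q by apply: contraNneq ps => ->.
    by have [h|h] := sep p q pP qP pq;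
      [exact: (order p q z pP qP h zp zq) | exact: (order q p z qP pP h zq zp)].
by rewrite mU.
Qed.

(** Each interval lies within a window of length [3 * delta], so inside a residue class
    modulo [3] the intervals are disjoint. *)
Lemma packing S P delta : 0 < delta ->
  (forall p, p \in P -> exists x : R, `[x, x + delta] `<=` S /\
     (p%:~R - 1) * delta <= x /\ x + delta <= (p%:~R + 2) * delta) ->
  ((#|` P|%fset%:R * delta)%:E <= 3%:E * lebesgue_measure S)%E.
Proof.
move=> d0 ex.
have ex' p : exists x : R, p \in P -> `[x, x + delta] `<=` S /\
     (p%:~R - 1) * delta <= x /\ x + delta <= (p%:~R + 2) * delta.
  have [/ex[x xP]|_] := boolP (p \in P); last by exists 0.
  by exists x.
have /choice[x xP] := ex'.
pose C (i : int) := [fset p in P | (p %% 3)%Z == i]%fset.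
have PC : (P `<=` C 0%R `|` C 1%R `|` C 2%:Z)%fset.
  apply/fsubsetP => p pP; rewrite !inE /= pP /=.
  have : (0 <= (p %% 3)%Z < 3)%R by rewrite modz_ge0 // ltz_pmod.
  by lia.
have hC i : ((#|` C i|%fset%:R * delta)%:E <= lebesgue_measure S)%E.
  apply: (packing_separated d0 (x := x)).
    by move=> p; rewrite !inE => /andP[pP _]; exact: xP.
  move=> p q; rewrite !inE /= => /andP[_ /eqP pi] /andP[_ /eqP qi] /eqP pq.
  by have := divz_eq p 3; have := divz_eq q 3; lia.
have cP : #|` P|%fset%:R <= #|` C 0%R|%fset%:R + #|` C 1%R|%fset%:R + #|` C 2%:Z|%fset%:R :> R.
  rewrite -!natrD ler_nat; apply: leq_trans (fsubset_leq_card PC) _.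
  apply: leq_trans (leq_card_fsetU _ _) _; rewrite leq_add2r; exact: leq_card_fsetU.
apply: (@le_trans _ _ ((#|` C 0%R|%fset%:R * delta)%:E +
   (#|` C 1%R|%fset%:R * delta)%:E + (#|` C 2%:Z|%fset%:R * delta)%:E)%E).
  by rewrite -!EFinD lee_fin -!mulrDl ler_wpM2r // ltW.
have e3 : (3%:E * lebesgue_measure S = lebesgue_measure S + lebesgue_measure S
   + lebesgue_measure S)%E.
  have -> : 3%:E = (1%:E + 1%:E + 1%:E)%E :> \bar R by rewrite -!EFinD; congr EFin; ring.
  by rewrite !ge0_muleDl ?mul1e ?adde_ge0 ?lee_fin.
by rewrite e3; apply: leeD; [apply: leeD|]; exact: hC.
Qed.

Section Discretize.
Variables (delta : R) (A : set R).
Hypothesis d0 : 0 < delta.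
Hypothesis A12 : A `<=` `[1, 2].
Hypothesis Adisc : delta_discretized delta A.

(** A union of closed intervals of length [delta] meets the grid of mesh [delta] in
    each of its intervals. *)
Definition grid_points : {fset int} :=
  [fset Posz i | i in [fset i in iota 0 (Num.truncn (2 / delta)).+1 |
     `[< A (i%:R * delta) >]]%fset]%fset.

Lemma grid_pointsP k : (k \in grid_points) <-> A (k%:~R * delta).
Proof.
split; first by move=> /imfsetP[i /=]; rewrite !inE /= => /andP[_ /asboolP ai] ->.
move=> ak; have := A12 ak; rewrite /= in_itv /= => /andP[k1 k2].
have k0 : 0 < k%:~R :> R by rewrite -(pmulr_lgt0 _ d0); lra.
have kE : k = Posz `|k|%N.
  by rewrite gez0_abs //; move: k0; rewrite ltr0z => /ltW.
rewrite kE; apply/imfsetP; exists `|k|%N => //=; rewrite !inE /=.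
apply/andP; split; last by apply/asboolP; rewrite -[_%:R]/((Posz `|k|)%:~R) -kE.
have h : (`|k| <= Num.truncn (2 / delta))%N.
  rewrite truncn_ge_nat ?divr_ge0 ?(ltW d0) // ler_pdivlMr //.
  by rewrite -[_%:R]/((Posz `|k|)%:~R) -kE.
by move: h; rewrite mem_iota; lia.
Qed.

Lemma grid_interval k : k \in grid_points -> exists x : R,
  [/\ `[x, x + delta] `<=` A, x <= k%:~R * delta & k%:~R * delta <= x + delta].
Proof.
move=> /grid_pointsP ak; case: Adisc => X AX.
move: (ak); rewrite AX => -[x Xx /=]; rewrite in_itv /= => /andP[xk kx].
by exists x; split => // z zx; exists x.
Qed.

Lemma card_grid_window (I : set R) (P : {fset int}) : (P `<=` grid_points)%fset ->
  (forall k z, k \in P -> (k%:~R - 1) * delta <= z <= (k%:~R + 1) * delta -> I z) ->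
  ((#|` P|%fset%:R * delta)%:E <= 3%:E * lebesgue_measure (A `&` I))%E.
Proof.
move=> /fsubsetP sP PI; apply: packing => // k kP.
have [x [sub xk kx]] := grid_interval (sP _ kP).
exists x; split; last by split; lra.
move=> z zx; split; first exact: sub.
move: zx; rewrite /= in_itv /= => /andP[z1 z2].
by apply: (PI k) => //; apply/andP; split; lra.
Qed.

Lemma card_grid_sums : ((#|` addfs grid_points grid_points|%:R * delta)%:E <=
  3%:E * lebesgue_measure (sumset A A))%E.
Proof.
apply: packing => // p /addfsP[k kA [l lA ->]].
have [x [sub xl lx]] := grid_interval lA.
have /grid_pointsP ak := kA.
exists (k%:~R * delta + x); rewrite intrD; split; last by split; lra.
move=> z; rewrite /= in_itv /= => /andP[z1 z2].
exists (k%:~R * delta) => //; exists (z - k%:~R * delta); last by rewrite addrC subrK.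
by apply: sub; rewrite /= in_itv /=; apply/andP; split; lra.
Qed.

(** The product of [k * delta] and an interval of length [delta] has length at least
    [delta] because [A] lies above [1]; the maximum selects in it an interval of
    length exactly [delta] around the product of the two grid points. *)
Lemma card_grid_products :
  ((#|` [fset dil delta^-1 p.1 p.2 | p in (grid_points `*` grid_points)%fset]|%fset%:R
     * delta)%:E <= 3%:E * lebesgue_measure (prodset A A))%E.
Proof.
apply: packing => // p /imfsetP[[k l] /=]; rewrite in_fsetM /= => /andP[kA lA] ->.
have [y [sub yl ly]] := grid_interval lA.
have /grid_pointsP ak := kA.
have := A12 ak; rewrite /= in_itv /= => /andP[t1 t2].
set t := k%:~R * delta in ak t1 t2.
set v := dil _ _ _.
have vE : k%:~R * l%:~R / delta^-1 = t * l%:~R by rewrite invrK /t; ring.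
have v1 : v%:~R * delta <= t * (l%:~R * delta).
  by rewrite mulrA ler_pM2r //; have := dil_le delta^-1 k l; rewrite vE.
have v2 : t * (l%:~R * delta) <= (v%:~R + 1) * delta.
  by rewrite mulrA ler_pM2r //; have := dil_gt delta^-1 k l; rewrite vE => /ltW.
have w1 : t * y <= t * (l%:~R * delta) by rewrite ler_pM2l //; lra.
have w2 : t * (l%:~R * delta) <= t * y + t * delta by rewrite -mulrDr ler_pM2l //; lra.
have td : delta <= t * delta by rewrite ler_peMl // ltW.
exists (Num.max (t * y) (t * (l%:~R * delta) - delta)).
have [m1 m2] : t * y <= Num.max (t * y) (t * (l%:~R * delta) - delta) /\
               t * (l%:~R * delta) - delta <= Num.max (t * y) (t * (l%:~R * delta) - delta).
  by rewrite !le_max !lexx orbT.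
have m3 : Num.max (t * y) (t * (l%:~R * delta) - delta) <= t * (l%:~R * delta).
  by rewrite ge_max w1 /= lerBlDr lerDl ltW.
have m4 : Num.max (t * y) (t * (l%:~R * delta) - delta) <= t * y + t * delta - delta.
  by rewrite ge_max; apply/andP; split; lra.
move: (Num.max _ _) m1 m2 m3 m4 => z m1 m2 m3 m4.
split; last by split; lra.
move=> u; rewrite /= in_itv /= => /andP[u1 u2].
have t0 : 0 < t by lra.
exists t => //; exists (u / t); last by rewrite mulrC divfK // gt_eqF.
apply: sub; rewrite /= in_itv /= ler_pdivlMr // ler_pdivrMr //.
by rewrite mulrDl ![_ * t]mulrC; apply/andP; split; lra.
Qed.

Lemma measure_le_grid : (lebesgue_measure A <= (2 * delta * #|` grid_points|%:R)%:E)%E.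
Proof.
pose J (k : int) : set R := `[(k%:~R - 1) * delta, (k%:~R + 1) * delta]%classic.
pose U := \big[setU/set0]_(k <- enum_fset grid_points) J k.
have measJ k : measurable (J k) by exact: measurable_itv.
have mJ k : lebesgue_measure (J k) = (2 * delta)%:E.
  rewrite lebesgue_measure_itv /= lte_fin ltr_pM2r // (_ : _ - 1 < _ + 1 :> R); last by lra.
  by rewrite -EFinB; congr EFin; ring.
apply: (@le_trans _ _ (lebesgue_measure U)).
  apply: le_lebesgue_measure => z Az.
  have [X AX] := Adisc.
  have [x Xx] : (\bigcup_(x in X) `[x, x + delta]%classic) z by rewrite -AX.
  rewrite /= in_itv /= => /andP[xz zx].
  pose k := Num.floor ((x + delta) / delta) : int.
  have k1 : k%:~R * delta <= x + delta by rewrite -ler_pdivlMr //; exact: ge_floor.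
  have k2 : x + delta < (k%:~R + 1) * delta.
    by rewrite -ltr_pdivrMr //; have := lt_succ_floor ((x + delta) / delta); rewrite intrD.
  have Ak : A (k%:~R * delta).
    by rewrite AX; exists x => //=; rewrite in_itv /=; apply/andP; split; lra.
  rewrite /U -bigcup_seq; exists k; first by apply/grid_pointsP.
  by rewrite /J /= in_itv /=; apply/andP; split; lra.
rewrite /U; elim: (enum_fset grid_points) => [|k s IH].
  by rewrite big_nil measure0 mulr0.
have mS : measurable (\big[setU/set0]_(k <- s) J k).
  by apply: bigsetU_measurable => *; exact: measJ.
rewrite big_cons; apply: (le_trans (measureU2 (@lebesgue_measure R) (measJ k) mS)).
have -> : (2 * delta * (size (k :: s))%:R)%:E = ((2 * delta)%:E + (2 * delta * (size s)%:R)%:E)%E.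
  by rewrite -EFinD /= -(natr1 (size s)); congr EFin; ring.
by apply: leeD => //; have := mJ k => /= ->.
Qed.

End Discretize.
End Transfer.

(** * The theorem *)

Section LogarithmicLoss.
Variable R : realType.

Lemma powR2_gt1 (eta : R) : 0 < eta -> 1 < 2 `^ eta.
Proof.
move=> eta0; have := @gt0_ltr_powR R eta eta0 1 2.
by rewrite !nnegrE powR1; apply; rewrite ?ler01 ?ler0n ?ltr1n.
Qed.

(** A logarithm is smaller than any power, by Bernoulli's inequality for
    [(2 `^ eta) ^+ L]. *)
Lemma log_le_powR (eta n : R) (L : nat) : 0 < eta -> 0 < n -> 2 ^+ L <= 8 * n ->
  L%:R <= (2 `^ eta - 1)^-1 * (8 * n) `^ eta.
Proof.
move=> eta0 n0 Ln.
have two := powR2_gt1 eta0.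
have bern i : 1 + i%:R * (2 `^ eta - 1) <= (2 `^ eta) ^+ i.
  elim: i => [|i IH]; first by rewrite mul0r addr0 expr0.
  have h : 0 <= i%:R :> R by [].
  rewrite exprS -natr1; apply: le_trans (_ : 2 `^ eta * (1 + i%:R * (2 `^ eta - 1)) <= _).
    move: (2 `^ eta) (i%:R : R) two h {IH} => x y x1 y0.
    rewrite -subr_ge0.
    have -> : x * (1 + y * (x - 1)) - (1 + (y + 1) * (x - 1)) = y * (x - 1) * (x - 1) by ring.
    by apply: mulr_ge0; [apply: mulr_ge0 => // |]; lra.
  by rewrite ler_wpM2l // powR_ge0.
have := bern L; have -> : (2 `^ eta) ^+ L = (2 ^+ L) `^ eta.
  by rewrite -powR_mulrn ?powR_ge0 // powRAC powR_mulrn.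
move=> h; rewrite mulrC ler_pdivlMr ?subr_gt0 //.
apply: le_trans (_ : (2 ^+ L) `^ eta <= _); first by lra.
by apply: (ge0_ler_powR (ltW eta0)); rewrite ?nnegrE ?exprn_ge0 ?mulr_ge0 // ltW.
Qed.

Lemma exists_log2 (n : R) : 1 <= n -> exists L : nat, 4 * n <= 2 ^+ L <= 8 * n.
Proof.
move=> n1.
have ex : exists L, 4 * n <= 2 ^+ L.
  exists (Num.truncn (4 * n)).+1.
  have n40 : 0 <= 4 * n by lra.
  have /andP[_ h] := truncn_itv n40.
  apply: le_trans (ltW h) _; rewrite -natrX ler_nat; exact/ltnW/ltn_expl.
case: (ex_minnP ex) => L hL minL; exists L; rewrite hL /=.
case: L hL minL => [|L] hL minL; first by rewrite expr0; lra.
rewrite leNgt; apply/negP => lt.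
have : 4 * n <= 2 ^+ L by move: lt; rewrite exprS; lra.
by move/minL; rewrite ltnn.
Qed.

End LogarithmicLoss.

Theorem theorem1p1 (R : realType) :
  exists2 M : R, 0 <= M &
  forall sigma c : R,
    0 < sigma < 1 ->
    c < sigma * (1 - sigma) / (4 * (7 + 3 * sigma)) ->
  exists2 kappa : R, 0 < kappa &
  forall (delta C : R) (A : set R),
    0 < delta ->
    0 < C ->
    A `<=` `[1, 2]%classic ->
    delta_discretized delta A ->
    lebesgue_measure A = (delta `^ (1 - sigma))%:E ->
    (forall I : interval R,
      (lebesgue_measure (A `&` [set` I])
        <= C%:E * lebesgue_measure [set` I] `^ sigma * lebesgue_measure A)%E) ->
    ((kappa * C `^ (- M) * delta `^ (- c))%:E * lebesgue_measure A
      <= lebesgue_measure (sumset A A) + lebesgue_measure (prodset A A))%E.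
Proof.
exists 1 => // sigma c sigma01 csmall; have /andP[s0 s1] := sigma01.
set e := 26 + 12 * sigma.
have e0 : 0 < e by rewrite /e; lra.
set eps := sigma * (1 - sigma) - c * e.
have eps0 : 0 < eps.
  have g0 : 0 < sigma * (1 - sigma) by rewrite mulr_gt0 // subr_gt0.
  have [c0|c0] := ltP c 0.
    have ce : c * e < 0 by rewrite pmulr_llt0.
    by rewrite /eps; lra.
  have : c * (4 * (7 + 3 * sigma)) < sigma * (1 - sigma).
    by rewrite -ltr_pdivlMr //; lra.
  by rewrite /eps /e; nra.
(* [eps] is the exponent left over to pay for the sixteenth power of a logarithm,
   and [Q] collects the constants that it brings. *)
set B0 := (2 `^ (eps / 16) - 1)^-1.
have eta0 : 0 < eps / 16 by rewrite divr_gt0.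
have two := powR2_gt1 eta0.
have B00 : 0 < B0 by rewrite invr_gt0 subr_gt0.
set Q := 2 ^+ 69 * 12 ^+ 9 * B0 ^+ 16 * 8 `^ eps.
have Q0 : 0 < Q.
  apply: mulr_gt0; last exact: powR_gt0.
  apply: mulr_gt0; last exact: exprn_gt0.
  by apply: mulr_gt0; exact: exprn_gt0.
(* [y] is [6 * kappa]: it is chosen so that [y `^ e * Q <= y * Q < 1]. *)
set y := Num.min 1 Q^-1 / 2.
have m0 : 0 < Num.min 1 Q^-1 by rewrite lt_min ltr01 invr_gt0.
have y0 : 0 < y by rewrite divr_gt0.
have y1 : y <= 1.
  have : Num.min 1 Q^-1 <= 1 by rewrite ge_min lexx.
  by rewrite /y; lra.
have yQ : y * Q < 1.
  have h : Num.min 1 Q^-1 * Q <= 1 by rewrite -ler_pdivlMr // div1r ge_min lexx orbT.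
  by rewrite /y mulrAC ltr_pdivrMr // mul1r (le_lt_trans h) // ltr1n.
exists (y / 6); first by rewrite divr_gt0.
move=> delta C A d0 C0 A12 Adisc mA nonconcA.
rewrite leNgt; apply/negP => small.
set n := delta^-1.
have n0 : 0 < n by rewrite invr_gt0.
have dn : delta * n = 1 by rewrite mulfV // gt_eqF.
set G := grid_points delta A.
set N : R := #|` G|%:R.
have md0 : 0 < delta `^ (1 - sigma) by exact: powR_gt0.
have Aneq : A !=set0.
  apply/set0P; apply/eqP => e0A; move: mA; rewrite e0A measure0 => /eqP.
  by rewrite eqe lt_eqF.
have d1 : delta <= 1.
  case: Aneq => a Aa; case: Adisc => X AX; move: (Aa); rewrite {1}AX => -[x Xx _].
  have sub z : `[x, x + delta]%classic z -> `[1, 2]%classic z.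
    by move=> xz; apply: A12; rewrite AX; exists x.
  have := sub x; have := sub (x + delta); rewrite /= !in_itv /= !lexx lerDl (ltW d0).
  by move=> /(_ isT)/andP[? ?] /(_ isT)/andP[? ?]; lra.
have n1 : 1 <= n by rewrite invf_ge1.
have e26 : 26 <= e by rewrite /e lerDl mulr_ge0 // ltW.
have m12 : lebesgue_measure `[1, 2 : R]%classic = 1%:E.
  by rewrite lebesgue_measure_itv /= lte_fin ltr1n -EFinB; congr EFin; ring.
have C1 : 1 <= C.
  have := nonconcA `[1, 2]; rewrite (setIidl A12) m12 poweR_EFin powR1 mule1 mA.
  by rewrite -EFinM lee_fin ler_pMl.
have dsplit : delta `^ sigma * delta `^ (1 - sigma) = delta.
  rewrite -powRD; first by rewrite addrC subrK powRr1 // ltW.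
  by rewrite (gt_eqF d0) implybT.
have AN : delta `^ (1 - sigma) <= 2 * delta * N.
  by have := measure_le_grid d0 A12 Adisc; rewrite mA lee_fin.
have N0 : 0 < N.
  have : 0 < 2 * delta * N by exact: lt_le_trans AN.
  by rewrite pmulr_rgt0 // mulr_gt0.
have NA : N * delta <= 3.
  have h := card_grid_window (I := setT) d0 A12 Adisc (fsubset_refl G) (fun _ _ _ _ => I).
  rewrite setIT in h; rewrite -lee_fin; apply: (le_trans h).
  have := le_lebesgue_measure A12; rewrite m12 => h'.
  apply: (@le_trans _ _ (3%:E * 1%:E)%E); last by rewrite mule1.
  by apply: lee_wpmul2l => //; rewrite lee_fin.
have [L /andP[L4 L8]] := exists_log2 n1.
have nonconcG c0 l : 1 <= l ->
    #|` [fset k in G | `|k%:~R - c0| <= l]|%fset%:R <= 12 * C * l `^ sigma.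
  move=> l1; set P := [fset k in _ | _]%fset.
  set a := (c0 - l - 1) * delta; set b := (c0 + l + 1) * delta.
  have PG : (P `<=` G)%fset by apply/fsubsetP => k; rewrite !inE /= => /andP[].
  have PI k z : k \in P -> (k%:~R - 1) * delta <= z <= (k%:~R + 1) * delta ->
      `[a, b]%classic z.
    rewrite !inE /= => /andP[_]; rewrite ler_norml => /andP[k1 k2] /andP[z1 z2].
    rewrite in_itv /=; apply/andP; split.
      by apply: le_trans z1; rewrite ler_pM2r //; lra.
    by apply: (le_trans z2); rewrite ler_pM2r //; lra.
  have h := card_grid_window d0 A12 Adisc PG PI.
  have ab : a < b by rewrite ltr_pM2r //; lra.
  have := nonconcA `[a, b]; rewrite lebesgue_measure_itv /= lte_fin ab -EFinB.
  rewrite poweR_EFin mA -!EFinM => h2.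
  have e3 : (0 <= 3%:E :> \bar R)%E by rewrite lee_fin.
  have : ((#|` P|%:R * delta)%:E <= 3%:E * (C * (b - a) `^ sigma * delta `^ (1 - sigma))%:E)%E.
    by apply: (le_trans h); apply: lee_wpmul2l.
  rewrite -EFinM lee_fin.
  have l0 : 0 <= l by lra.
  have ba : (b - a) `^ sigma <= 4 * (l `^ sigma * delta `^ sigma).
    have c4 : 1 <= 4 :> R by rewrite ler1n.
    have ld0 : 0 <= l * delta by rewrite mulr_ge0 // ltW.
    rewrite -powRM ?(ltW d0) //; apply: le_trans (powR_scale sigma01 c4 ld0).
    have baE : b - a = 2 * (l + 1) * delta by rewrite /a /b; ring.
    apply: (ge0_ler_powR (ltW s0)); rewrite ?nnegrE ?baE.
    - by rewrite mulr_ge0 ?(ltW d0) //; lra.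
    - by rewrite mulr_ge0.
    - by rewrite mulrA ler_pM2r //; lra.
  move=> h3; rewrite -(ler_pM2r d0); apply: (le_trans h3).
  have -> : 12 * C * l `^ sigma * delta =
     3 * (C * (4 * (l `^ sigma * delta `^ sigma)) * delta `^ (1 - sigma)).
    by rewrite -[in LHS]dsplit; ring.
  rewrite ler_pM2l // ler_pM2r // ler_pM2l //.
set Kc := y / 6 * C `^ (-1) * delta `^ (- c) in small.
have Kc0 : 0 < Kc.
  by apply: mulr_gt0; [apply: mulr_gt0; [exact: divr_gt0 | exact: powR_gt0] | exact: powR_gt0].
set K := 6 * Kc.
have small_set (S : set R) (P : {fset int}) :
    (lebesgue_measure S <= lebesgue_measure (sumset A A) + lebesgue_measure (prodset A A))%E ->
    ((#|` P|%fset%:R * delta)%:E <= 3%:E * lebesgue_measure S)%E ->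
    #|` P|%fset%:R <= K * N.
  move=> hS hP.
  have h : ((#|` P|%fset%:R * delta)%:E <= 3%:E * (Kc * delta `^ (1 - sigma))%:E)%E.
    apply: (le_trans hP); apply: lee_wpmul2l; first by rewrite lee_fin.
    by apply: (le_trans hS); rewrite EFinM -mA; exact: ltW.
  move: h; rewrite -EFinM lee_fin => h.
  rewrite -(ler_pM2r d0); apply: (le_trans h).
  have -> : K * N * delta = 3 * (Kc * (2 * delta * N)) by rewrite /K; ring.
  by rewrite ler_pM2l // ler_pM2l.
have doubling : #|` addfs G G|%:R <= K * N.
  by apply: (small_set _ _ _ (card_grid_sums d0 A12 Adisc)); rewrite leeDl.
have product : #|` [fset dil n p.1 p.2 | p in (G `*` G)%fset]|%fset%:R <= K * N.
  by apply: (small_set _ _ _ (card_grid_products d0 A12 Adisc)); rewrite leeDr.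
have Grange k : k \in G -> n <= k%:~R <= 2 * n.
  move=> /(grid_pointsP d0 A12)/A12; rewrite /= in_itv /= => /andP[k1 k2].
  have -> : k%:~R = k%:~R * delta * n by rewrite -mulrA dn mulr1.
  by rewrite ler_peMl ?(ltW n0) //= ler_pM2r.
have NL : (#|` G| < 2 ^ L)%N.
  rewrite -(ltr_nat R) natrX; apply: lt_le_trans L4.
  have : N * (delta * n) <= 3 * n by rewrite mulrA ler_pM2r.
  by rewrite dn mulr1 -/N; lra.
have nL : n <= 2 ^+ L by apply: le_trans L4; lra.
have N_lower : n `^ sigma <= 2 * N.
  have ns : n `^ sigma * delta `^ sigma = 1.
    by rewrite -powRM ?(ltW n0) ?(ltW d0) // mulrC dn powR1.
  have ds0 : 0 < delta `^ sigma by exact: powR_gt0.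
  rewrite -(ler_pM2r ds0) ns -(ler_pM2r md0) mul1r -mulrA dsplit.
  by rewrite mulrAC.
have Gneq : G != fset0 by rewrite -cardfs_gt0 -(ltr0n R).
have C12 : 1 <= 12 * C by lra.
have K0 : 0 <= K by rewrite mulr_ge0 // ltW.
have main := discrete_sum_product n1 sigma01 Gneq Grange C12 nonconcG K0 doubling
  product NL nL N_lower.
rewrite -/e in main.
have KE : K `^ e * (12 * C) ^+ 9 <= y * 12 ^+ 9 * n `^ (c * e).
  have -> : K = y * (C^-1 * delta `^ (- c)).
    by rewrite /K /Kc powR_inv1 ?(ltW C0) //; field; exact: lt0r_neq0.
  have nc : delta `^ (- c) = n `^ c.
    have -> : n = delta `^ (-1) by rewrite powR_inv1 // ltW.
    by rewrite -powRrM mulN1r.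
  rewrite nc powRM ?(ltW y0) //; last by rewrite mulr_ge0 ?invr_ge0 ?(ltW C0) ?powR_ge0.
  have Ci0 : 0 <= C^-1 by rewrite invr_ge0 ltW.
  rewrite (powRM e Ci0 (powR_ge0 n c)) -powRrM exprMn.
  have ye : y `^ e <= y.
    have y01 : 0 < y <= 1 by rewrite y0.
    rewrite -[leRHS]powRr1 ?(ltW y0) //; apply: ger_powR => //.
    by apply: le_trans e26; rewrite ler1n.
  have Ce : C^-1 `^ e * C ^+ 9 <= 1.
    have -> : C^-1 `^ e = (C `^ e)^-1 by rewrite -powRN -mulN1r powRrM powR_inv1 // ltW.
    rewrite mulrC ler_pdivrMr ?powR_gt0 // mul1r -powR_mulrn ?(ltW C0) //.
    by apply: ler_powR => //; apply: le_trans e26; rewrite ler_nat.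
  have -> : y `^ e * (C^-1 `^ e * n `^ (c * e)) * (12 ^+ 9 * C ^+ 9) =
    y `^ e * (C^-1 `^ e * C ^+ 9) * (12 ^+ 9 * n `^ (c * e)) by ring.
  rewrite -[leRHS]mulrA; apply: ler_wpM2r.
    by apply: mulr_ge0; [exact: exprn_ge0 | exact: powR_ge0].
  rewrite -[leRHS]mulr1; apply: ler_pM => //; rewrite ?powR_ge0 //.
  by rewrite mulr_ge0 ?powR_ge0 // exprn_ge0 // ltW.
have LE : L%:R ^+ 16 <= B0 ^+ 16 * 8 `^ eps * n `^ eps.
  have := log_le_powR eta0 n0 L8; rewrite -/B0 => h.
  apply: le_trans (_ : (B0 * (8 * n) `^ (eps / 16)) ^+ 16 <= _).
    by rewrite lerXn2r ?nnegrE ?mulr_ge0 ?powR_ge0 // ltW.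
  have root : ((8 * n) `^ (eps / 16)) ^+ 16 = (8 * n) `^ eps.
    by rewrite -powR_mulrn ?powR_ge0 // -powRrM divfK // pnatr_eq0.
  by rewrite exprMn root powRM ?(ltW n0) // mulrA.
have split_n : n `^ (sigma * (1 - sigma)) = n `^ (c * e) * n `^ eps.
  rewrite -powRD; first by congr (_ `^ _); rewrite /eps; ring.
  by rewrite (gt_eqF n0) implybT.
have : n `^ (sigma * (1 - sigma)) <= (y * Q) * n `^ (sigma * (1 - sigma)).
  apply: (le_trans main).
  have -> : 2 ^+ 69 * K `^ e * L%:R ^+ 16 * (12 * C) ^+ 9 =
    2 ^+ 69 * (K `^ e * (12 * C) ^+ 9) * L%:R ^+ 16 by ring.
  have -> : y * Q * n `^ (sigma * (1 - sigma)) =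
    2 ^+ 69 * (y * 12 ^+ 9 * n `^ (c * e)) * (B0 ^+ 16 * 8 `^ eps * n `^ eps).
    by rewrite split_n /Q; ring.
  have p69 : 0 <= 2 ^+ 69 :> R by exact: exprn_ge0.
  have pK : 0 <= K `^ e * (12 * C) ^+ 9.
    by apply: mulr_ge0; [exact: powR_ge0 | apply: exprn_ge0; lra].
  apply: ler_pM; [exact: mulr_ge0 | exact: exprn_ge0 | exact: ler_wpM2l | exact: LE].
by rewrite leNgt gtr_pMl ?yQ // powR_gt0.
Qed.
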